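(* For any two structures $\mathfrak A$ and $\mathfrak B$ (for the same first-order language) there is a structure $\mathfrak C=\mathfrak C(\mathfrak A,\mathfrak B)$ such that in any extension $V'\supseteq V$ of the set-theoretic universe (in particular in any forcing extension), $V'\models$ ''$\mathfrak A\cong\mathfrak B$ if and only if $\mathfrak C$ is not rigid''.
   Context: A structure is rigid if its only automorphism is the identity; it is not rigid if it admits a nontrivial automorphism. *)

(* Defs.v *)
Set Implicit Arguments.
Unset Strict Implicit.

(* Universes of sets are first-order models of ZFC: a carrier with a binary
   relation. The carrier may be a proper class from the point of view of the
   model, so nothing bounds its size. *)
Record set_universe : Type := SetUniverse {
  carrier :> Type;
  mem : carrier -> carrier -> Prop }.

Declare Scope set_scope.
Delimit Scope set_scope with set.
Notation "x ∈ y" := (mem x y) (at level 70, no associativity) : set_scope.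
Open Scope set_scope.

(* First-order formulas of the language of set theory, with de Bruijn indices.
   They are needed for the two axiom schemes only: quantifying over arbitrary
   predicates of the metatheory would give second-order ZFC, whose models have
   no proper forcing extensions. *)
Inductive formula : Type :=
| fMem (i j : nat)
| fEq (i j : nat)
| fBot
| fAnd (p q : formula)
| fOr (p q : formula)
| fImp (p q : formula)
| fAll (p : formula)
| fEx (p : formula).

Definition push (M : Type) (x : M) (v : nat -> M) : nat -> M :=
  fun n => match n with O => x | S k => v k end.

Fixpoint sat (M : set_universe) (v : nat -> M) (p : formula) : Prop :=
  match p with
  | fMem i j => v i ∈ v j
  | fEq i j => v i = v j
  | fBot => False
  | fAnd p q => sat v p /\ sat v q
  | fOr p q => sat v p \/ sat v q
  | fImp p q => sat v p -> sat v q
  | fAll p => forall x : M, sat (push x v) p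
  | fEx p => exists x : M, sat (push x v) p
  end.

(* From here on every quantifier over sets ranges over the carrier of a given
   M : set_universe, so that a predicate "P x y" about elements of M is the
   unfolding of "M satisfies P(x, y)". *)

Definition subset (M : set_universe) (x y : M) : Prop :=
  forall z : M, z ∈ x -> z ∈ y.

Definition is_empty (M : set_universe) (x : M) : Prop :=
  forall z : M, ~ z ∈ x.

Definition is_succ (M : set_universe) (y x : M) : Prop :=
  forall z : M, z ∈ y <-> z ∈ x \/ z = x.

Definition is_inductive (M : set_universe) (w : M) : Prop :=
  (exists e : M, is_empty e /\ e ∈ w) /\
  (forall x : M, x ∈ w -> exists y : M, is_succ y x /\ y ∈ w).

Definition is_omega (M : set_universe) (w : M) : Prop :=
  is_inductive w /\ forall u : M, is_inductive u -> subset w u.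

Definition is_upair (M : set_universe) (p x y : M) : Prop :=
  forall z : M, z ∈ p <-> z = x \/ z = y.

(* Kuratowski pairs: p = {{x}, {x, y}}. *)
Definition is_opair (M : set_universe) (p x y : M) : Prop :=
  exists a b : M, is_upair a x x /\ is_upair b x y /\ is_upair p a b.

Record ZFC (M : set_universe) : Prop := {
  zfc_extensionality : forall x y : M, (forall z : M, z ∈ x <-> z ∈ y) -> x = y;
  zfc_foundation : forall x : M, (exists y : M, y ∈ x) ->
    exists y : M, y ∈ x /\ forall z : M, z ∈ y -> ~ z ∈ x;
  zfc_pairing : forall x y : M, exists p : M, is_upair p x y;
  zfc_union : forall x : M, exists u : M,
    forall z : M, z ∈ u <-> exists y : M, y ∈ x /\ z ∈ y;
  zfc_powerset : forall x : M, exists p : M,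
    forall z : M, z ∈ p <-> subset z x;
  zfc_infinity : exists w : M, is_inductive w;
  zfc_separation : forall (p : formula) (v : nat -> M) (x : M), exists y : M,
    forall z : M, z ∈ y <-> z ∈ x /\ sat (push z v) p;
  zfc_replacement : forall (p : formula) (v : nat -> M) (x : M),
    (forall a b b' : M, a ∈ x ->
       sat (push a (push b v)) p -> sat (push a (push b' v)) p -> b = b') ->
    exists y : M, forall b : M,
      b ∈ y <-> exists a : M, a ∈ x /\ sat (push a (push b v)) p;
  zfc_choice : forall x : M,
    (forall y : M, y ∈ x -> exists z : M, z ∈ y) ->
    (forall y y' z : M, y ∈ x -> y' ∈ x -> z ∈ y -> z ∈ y' -> y = y') ->
    exists c : M, forall y : M, y ∈ x -> exists! z : M, z ∈ y /\ z ∈ c }.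

(* V' is an extension of V when V is (isomorphic to) a transitive class of V'.
   The class need not be definable in V'. *)
Record extension (V V' : set_universe) : Type := Extension {
  incl :> V -> V';
  incl_inj : forall x y : V, incl x = incl y -> x = y;
  incl_mem : forall x y : V, x ∈ y <-> incl x ∈ incl y;
  incl_trans : forall (x : V) (y' : V'), y' ∈ incl x -> exists y : V, y' = incl y }.

(* "f(x) = y" for a set f of ordered pairs. *)
Definition maps_to (M : set_universe) (f x y : M) : Prop :=
  exists p : M, is_opair p x y /\ p ∈ f.

Definition is_function (M : set_universe) (f X Y : M) : Prop :=
  (forall p : M, p ∈ f -> exists x y : M, x ∈ X /\ y ∈ Y /\ is_opair p x y) /\
  (forall x : M, x ∈ X -> exists! y : M, maps_to f x y).

Definition is_bijection (M : set_universe) (f X Y : M) : Prop :=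
  is_function f X Y /\
  (forall x x' y : M, maps_to f x y -> maps_to f x' y -> x = x') /\
  (forall y : M, y ∈ Y -> exists x : M, maps_to f x y).

(* First-order languages as sets of M: constants are the function symbols of
   arity 0; arities are von Neumann natural numbers of M. *)
Record language (M : set_universe) : Type := Language {
  rel_symb : M;
  rel_arity : M;
  fun_symb : M;
  fun_arity : M }.

Definition is_language (M : set_universe) (L : language M) : Prop :=
  exists w : M, is_omega w /\
    is_function (rel_arity L) (rel_symb L) w /\
    is_function (fun_arity L) (fun_symb L) w.

(* A structure is a triple of sets: its domain and the two functions sending
   the symbols of the language to their interpretations. *)
Record structure (M : set_universe) : Type := Structure {
  dom : M;
  rel_interp : M;
  fun_interp : M }.

(* n-tuples over X are the functions from n = {0, ..., n-1} to X. *)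
Definition is_relation_on (M : set_universe) (R n X : M) : Prop :=
  forall s : M, s ∈ R -> is_function s n X.

Definition is_operation_on (M : set_universe) (F n X : M) : Prop :=
  exists T : M, (forall s : M, s ∈ T <-> is_function s n X) /\ is_function F T X.

Definition is_structure (M : set_universe) (L : language M) (A : structure M)
  : Prop :=
  (exists x : M, x ∈ dom A) /\
  (exists Y : M, is_function (rel_interp A) (rel_symb L) Y) /\
  (forall r n R : M, maps_to (rel_arity L) r n -> maps_to (rel_interp A) r R ->
     is_relation_on R n (dom A)) /\
  (exists Y : M, is_function (fun_interp A) (fun_symb L) Y) /\
  (forall g n F : M, maps_to (fun_arity L) g n -> maps_to (fun_interp A) g F ->
     is_operation_on F n (dom A)).

(* t is the n-tuple over Y obtained by applying f to the entries of s. *)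
Definition is_tuple_image (M : set_universe) (f n Y s t : M) : Prop :=
  is_function t n Y /\
  forall i x y : M, maps_to s i x -> maps_to f x y -> maps_to t i y.

Definition is_isomorphism (M : set_universe) (L : language M)
  (A B : structure M) (f : M) : Prop :=
  is_bijection f (dom A) (dom B) /\
  (forall r n R R' s t : M,
     maps_to (rel_arity L) r n ->
     maps_to (rel_interp A) r R -> maps_to (rel_interp B) r R' ->
     is_function s n (dom A) -> is_tuple_image f n (dom B) s t ->
     (s ∈ R <-> t ∈ R')) /\
  (forall g n F F' s t x y : M,
     maps_to (fun_arity L) g n ->
     maps_to (fun_interp A) g F -> maps_to (fun_interp B) g F' ->
     is_function s n (dom A) -> is_tuple_image f n (dom B) s t ->
     maps_to F s x -> maps_to f x y -> maps_to F' t y).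

Definition isomorphic (M : set_universe) (L : language M) (A B : structure M)
  : Prop :=
  exists f : M, is_isomorphism L A B f.

Definition rigid (M : set_universe) (L : language M) (A : structure M) : Prop :=
  forall f : M, is_isomorphism L A A f ->
    forall x : M, x ∈ dom A -> maps_to f x x.

(* The same language and the same structure, looked at in the extension. *)
Definition language_in (V V' : set_universe) (j : extension V V')
  (L : language V) : language V' :=
  Language (j (rel_symb L)) (j (rel_arity L))
           (j (fun_symb L)) (j (fun_arity L)).

Definition structure_in (V V' : set_universe) (j : extension V V')
  (A : structure V) : structure V' :=
  Structure (j (dom A)) (j (rel_interp A)) (j (fun_interp A)).

(* Main.v *)
From Stdlib Require Import Classical ClassicalEpsilon Arith Lia.
Require Import Defs.

(** Suppose that A and B are not isomorphic. Then "being A" and "being B" are two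
    distinguishable values of a bit, and the elements of any set can be named by
    bits, hence by copies of A and B. So let C have two roots p and q, and below
    every element y, for every index i of a fixed set, a copy of B if i = y and a
    copy of A otherwise; the elements of these copies carry copies in turn, and so
    on. If A and B are not isomorphic, an automorphism of C respects the types of
    the copies, so it respects the labels y, and by induction on the level it is
    the identity: the automorphisms of A and B are killed by the copies below
    their elements. If f : A -> B is an isomorphism, all the copies are isomorphic,
    and a recursion over the levels that applies f, its inverse or the identity in
    each copy extends the exchange of p and q to an automorphism of C. The
    construction of C only involves finite sequences, so it is absolute. *)

Set Implicit Arguments.
Unset Strict Implicit.

(** * Definable predicates *)

(** The obstacle is that [A] and [B] may become isomorphic only in the extension, through a map
    outside [V]. So [C] is fixed in [V], while both directions are argued inside [V'], where [V]
    need not be definable. To this end the properties used of the tree, of the codes of [A] and [B],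
    and of their interpretations are collected in [tree], [is_code] and [wf_structure]; these pass
    to the extension, and the arguments work in any model of ZFC from these lists. Every node has a
    copy for each index, so that its label is visible as the only index whose copy has the type of
    [B]. Copies of structures in an arbitrary language cannot be put side by side, because an
    operation on one copy is not an operation on all of [C]; hence [A] and [B] are replaced by codes
    with binary relations only. Transitivity of [V] does not suffice for the totality of the
    operations in [V']: there the tuples of [V'] over a set of [V] must be shown to lie in [V],
    which holds because arities are finite. The schemes of ZFC speak of formulas, so each use of
    separation needs a proof that its predicate is first-order definable. *)

Definition shift (M : Type) (v : nat -> M) : nat -> M := fun n => v (S n).

Definition up (r : nat -> nat) (n : nat) : nat :=
  match n with O => O | S k => S (r k) end.

Fixpoint ren (r : nat -> nat) (p : formula) : formula :=
  match p with
  | fMem i j => fMem (r i) (r j)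
  | fEq i j => fEq (r i) (r j)
  | fBot => fBot
  | fAnd p q => fAnd (ren r p) (ren r q)
  | fOr p q => fOr (ren r p) (ren r q)
  | fImp p q => fImp (ren r p) (ren r q)
  | fAll p => fAll (ren (up r) p)
  | fEx p => fEx (ren (up r) p)
  end.

Lemma sat_ren (M : set_universe) (p : formula) : forall (r : nat -> nat) (v w : nat -> M),
  (forall n, w n = v (r n)) -> (sat v (ren r p) <-> sat w p).
Proof.
  induction p as [i j|i j| |p IHp q IHq|p IHp q IHq|p IHp q IHq|p IHp|p IHp];
    intros r v w H; simpl.
  1,2: rewrite !H; tauto.
  1: tauto.
  1-3: rewrite (IHp _ _ _ H), (IHq _ _ _ H); tauto.
  all: assert (H' : forall (x : M) n, push x w n = push x v (up r n))
    by (intros x [|n]; simpl; auto).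
  - split; intros K x; [apply (IHp _ _ _ (H' x))|apply (IHp _ _ _ (H' x))]; apply K.
  - split; intros [x K]; exists x; revert K; apply (IHp _ _ _ (H' x)).
Qed.

(* Variables sit at the even indices, so that quantifying over one of them
   leaves room for the parameters at the odd ones. *)
Definition mix (M : Type) (v c : nat -> M) (n : nat) : M :=
  if Nat.even n then v (Nat.div2 n) else c (Nat.div2 n).

Lemma mix_even (M : Type) (v c : nat -> M) n : mix v c (2 * n) = v n.
Proof.
  unfold mix. rewrite Nat.even_mul, Nat.div2_double. reflexivity.
Qed.

Lemma mix_odd (M : Type) (v c : nat -> M) n : mix v c (S (2 * n)) = c n.
Proof.
  unfold mix. rewrite Nat.even_succ, Nat.odd_mul, Nat.div2_succ_double. reflexivity.
Qed.

Lemma even_odd_split n : (exists k, n = 2 * k) \/ exists k, n = S (2 * k).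
Proof.
  destruct (Nat.Even_or_Odd n) as [[k H]|[k H]]; [left|right]; exists k; lia.
Qed.

(** The bridge from predicates of Rocq to the axiom schemes. The sequence [c] holds parameters, so
    that any fixed sets of [M] may occur in [P]. *)
Definition Dfn (M : set_universe) (P : (nat -> M) -> Prop) : Prop :=
  exists (p : formula) (c : nat -> M), forall v, sat (mix v c) p <-> P v.

(** Terms such as [pr] are not in the language, so a term counts as definable when its graph is:
    index 0 holds the value, the remaining indices the arguments. *)
Definition DT (M : set_universe) (t : (nat -> M) -> M) : Prop :=
  Dfn (fun v => v 0 = t (shift v)).

Lemma Dfn_ext (M : set_universe) (P Q : (nat -> M) -> Prop) :
  (forall v, P v <-> Q v) -> Dfn P -> Dfn Q.
Proof.
  intros H (p & c & K). exists p, c. intros v. rewrite K. apply H.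
Qed.

Lemma Dfn_ren (M : set_universe) (r : nat -> nat) (P : (nat -> M) -> Prop) :
  Dfn P -> Dfn (fun v => P (fun n => v (r n))).
Proof.
  intros (p & c & H).
  exists (ren (fun n => if Nat.even n then 2 * r (Nat.div2 n) else n) p), c.
  intros v. rewrite <- H. apply sat_ren. intros n.
  destruct (even_odd_split n) as [[k ->]|[k ->]].
  - rewrite mix_even, Nat.even_mul, Nat.div2_double. simpl orb. cbv iota.
    rewrite mix_even. reflexivity.
  - rewrite Nat.even_succ, Nat.odd_mul. simpl Nat.odd. simpl andb. cbv iota.
    rewrite !mix_odd. reflexivity.
Qed.

Lemma mix_params (M : set_universe) (P : (nat -> M) -> Prop) (c : nat -> M) p :
  (forall v, sat (mix v c) p <-> P v) ->
  forall (r : nat -> nat) (d : nat -> M), (forall n, c n = d (r n)) ->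
  exists q, forall v, sat (mix v d) q <-> P v.
Proof.
  intros H r d K.
  exists (ren (fun n => if Nat.even n then n else S (2 * r (Nat.div2 n))) p).
  intros v. rewrite <- H. apply sat_ren. intros n.
  destruct (even_odd_split n) as [[k ->]|[k ->]].
  - rewrite Nat.even_mul. simpl orb. cbv iota. rewrite !mix_even. reflexivity.
  - rewrite Nat.even_succ, Nat.odd_mul, Nat.div2_succ_double.
    simpl Nat.odd. simpl andb. cbv iota. rewrite !mix_odd. apply K.
Qed.

(** Two formulas come with two parameter sequences; interleaving the sequences puts both formulas
    over one, so that a connective can join them. *)
Lemma Dfn_common (M : set_universe) (P Q : (nat -> M) -> Prop) :
  Dfn P -> Dfn Q -> exists p q c, (forall v, sat (mix v c) p <-> P v) /\
    (forall v, sat (mix v c) q <-> Q v).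
Proof.
  intros (p & c & H) (q & d & K).
  destruct (@mix_params _ P c p H (fun n => 2 * n) (mix c d)) as [p' Hp].
  { intros n. rewrite mix_even. reflexivity. }
  destruct (@mix_params _ Q d q K (fun n => S (2 * n)) (mix c d)) as [q' Hq].
  { intros n. rewrite mix_odd. reflexivity. }
  exists p', q', (mix c d). split; assumption.
Qed.

Lemma Dfn_and (M : set_universe) (P Q : (nat -> M) -> Prop) :
  Dfn P -> Dfn Q -> Dfn (fun v => P v /\ Q v).
Proof.
  intros HP HQ. destruct (Dfn_common HP HQ) as (p & q & c & H & K).
  exists (fAnd p q), c. intros v. simpl. rewrite H, K. tauto.
Qed.

Lemma Dfn_or (M : set_universe) (P Q : (nat -> M) -> Prop) :
  Dfn P -> Dfn Q -> Dfn (fun v => P v \/ Q v).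
Proof.
  intros HP HQ. destruct (Dfn_common HP HQ) as (p & q & c & H & K).
  exists (fOr p q), c. intros v. simpl. rewrite H, K. tauto.
Qed.

Lemma Dfn_imp (M : set_universe) (P Q : (nat -> M) -> Prop) :
  Dfn P -> Dfn Q -> Dfn (fun v => P v -> Q v).
Proof.
  intros HP HQ. destruct (Dfn_common HP HQ) as (p & q & c & H & K).
  exists (fImp p q), c. intros v. simpl. rewrite H, K. tauto.
Qed.

Lemma Dfn_False (M : set_universe) (c : M) : Dfn (fun _ : nat -> M => False).
Proof.
  exists fBot, (fun _ => c). intros v. simpl. tauto.
Qed.

Lemma Dfn_iff (M : set_universe) (P Q : (nat -> M) -> Prop) :
  Dfn P -> Dfn Q -> Dfn (fun v => P v <-> Q v).
Proof.
  intros HP HQ. apply Dfn_and; apply Dfn_imp; assumption.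
Qed.

Lemma Dfn_not (M : set_universe) (P : (nat -> M) -> Prop) :
  Dfn P -> Dfn (fun v => ~ P v).
Proof.
  intros HP. apply Dfn_imp; [assumption|]. destruct HP as (p & c & H).
  apply (Dfn_False (c 0)).
Qed.

(** A quantifier of [sat] moves every index up by one, whereas a new variable in [mix] moves the
    variables by two and leaves the parameters in place. This renaming reconciles the two: variable
    0 becomes the bound one, variable k + 1 is found at [S (2 * k)], and parameters move up by
    one. *)
Definition bind (n : nat) : nat :=
  if Nat.even n then match Nat.div2 n with O => O | S k => S (2 * k) end else S n.

Lemma mix_bind (M : set_universe) (x : M) (v c : nat -> M) n :
  mix (push x v) c n = push x (mix v c) (bind n).
Proof.
  unfold bind. destruct (even_odd_split n) as [[k ->]|[k ->]].
  - rewrite Nat.even_mul, Nat.div2_double, mix_even. simpl orb. cbv iota.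
    destruct k as [|k]; [reflexivity|]. change (v k = mix v c (2 * k)).
    rewrite mix_even. reflexivity.
  - rewrite Nat.even_succ, Nat.odd_mul. simpl Nat.odd. simpl andb. cbv iota.
    rewrite mix_odd. change (c k = mix v c (S (2 * k))).
    rewrite mix_odd. reflexivity.
Qed.

Lemma Dfn_all (M : set_universe) (P : M -> (nat -> M) -> Prop) :
  Dfn (fun v => P (v 0) (fun n => v (S n))) -> Dfn (fun v => forall x, P x v).
Proof.
  intros (p & c & H). exists (fAll (ren bind p)), c. intros v. simpl.
  split; intros K x.
  - apply (H (push x v)). generalize (K x).
    apply sat_ren. intros n. apply mix_bind.
  - apply (sat_ren p (mix_bind x v c)). apply H. simpl. apply K.
Qed.

Lemma Dfn_ex (M : set_universe) (P : M -> (nat -> M) -> Prop) :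
  Dfn (fun v => P (v 0) (fun n => v (S n))) -> Dfn (fun v => exists x, P x v).
Proof.
  intros (p & c & H). exists (fEx (ren bind p)), c. intros v. simpl.
  split; intros [x K]; exists x.
  - apply (H (push x v)). revert K.
    apply sat_ren. intros n. apply mix_bind.
  - apply (sat_ren p (mix_bind x v c)). apply H. simpl. apply K.
Qed.

Lemma ZFC_inhabited (M : set_universe) (HM : ZFC M) : inhabited M.
Proof.
  destruct (zfc_infinity HM) as [w _]. constructor. exact w.
Qed.

Lemma DT_var (M : set_universe) (HM : ZFC M) (i : nat) : DT (fun v : nat -> M => v i).
Proof.
  destruct (ZFC_inhabited HM) as [a].
  exists (fEq 0 (2 * S i)), (fun _ => a). intros v. simpl sat.
  change (mix v (fun _ => a) (2 * 0) = mix v (fun _ => a) (2 * S i) <-> v 0 = shift v i).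
  rewrite !mix_even. unfold shift. tauto.
Qed.

Lemma DT_const (M : set_universe) (a : M) : DT (fun _ => a).
Proof.
  exists (fEq 0 1), (fun _ => a). intros v. simpl. unfold mix. simpl. tauto.
Qed.

Lemma DT_ren (M : set_universe) (r : nat -> nat) (t : (nat -> M) -> M) :
  DT t -> DT (fun v => t (fun n => v (r n))).
Proof.
  intros H. exact (Dfn_ren (up r) H).
Qed.

Lemma Dfn_mem_var (M : set_universe) (HM : ZFC M) i j :
  Dfn (fun v : nat -> M => v i ∈ v j).
Proof.
  destruct (ZFC_inhabited HM) as [a].
  exists (fMem (2 * i) (2 * j)), (fun _ => a). intros v. simpl sat.
  change (mix v (fun _ => a) (2 * i) ∈ mix v (fun _ => a) (2 * j) <-> v i ∈ v j).
  rewrite !mix_even. tauto.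
Qed.

Lemma Dfn_mem (M : set_universe) (HM : ZFC M) (t u : (nat -> M) -> M) :
  DT t -> DT u -> Dfn (fun v => t v ∈ u v).
Proof.
  intros Ht Hu.
  apply Dfn_ext with (P := fun v => exists a, a = t v /\ exists b, b = u v /\ a ∈ b).
  { intros v. split; [intros (a & -> & b & -> & H); exact H|eauto]. }
  apply Dfn_ex. apply Dfn_and; [exact Ht|]. apply Dfn_ex.
  apply Dfn_and; [exact (DT_ren S Hu)|]. exact (Dfn_mem_var HM 1 0).
Qed.

Lemma Dfn_eq (M : set_universe) (HM : ZFC M) (t u : (nat -> M) -> M) :
  DT t -> DT u -> Dfn (fun v => t v = u v).
Proof.
  intros Ht Hu.
  apply Dfn_ext with (P := fun v => exists a, a = t v /\ a = u v).
  { intros v. split; [intros (a & -> & H); exact H|eauto]. }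
  apply Dfn_ex. apply Dfn_and; [exact Ht|exact Hu].
Qed.

(** Definability is proved by following the syntax of the predicate. Implications and universal
    quantifiers are both products, so unification tells them apart, with [Dfn_imp] tried before
    [Dfn_all]. *)
Ltac dfn_base :=
  cbv beta;
  match goal with
  | |- Dfn (fun v => _ /\ _) => apply Dfn_and
  | |- Dfn (fun v => _ \/ _) => apply Dfn_or
  | |- Dfn (fun v => _ <-> _) => apply Dfn_iff
  | |- Dfn (fun v => ~ _) => apply Dfn_not
  | |- Dfn (fun v => exists _, _) => apply Dfn_ex
  | |- Dfn (fun v => _ ∈ _) => apply Dfn_mem; [assumption| |]
  | |- Dfn (fun v => _ = _) => apply Dfn_eq; [assumption| |]
  | |- Dfn _ => first [apply Dfn_imp | apply Dfn_all]
  | |- DT _ => first [apply DT_var; assumption | apply DT_const]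
  end.

(** * Sets in a model of ZFC *)

Lemma separation (M : set_universe) (HM : ZFC M) (P : M -> Prop) (x : M) :
  Dfn (fun v => P (v 0)) -> exists y, forall z, z ∈ y <-> z ∈ x /\ P z.
Proof.
  intros (p & c & H).
  destruct (zfc_separation HM (ren bind p) (mix (fun _ => x) c) x) as [y Hy].
  exists y. intros z. rewrite Hy, (sat_ren p (mix_bind z (fun _ => x) c)), H.
  simpl. tauto.
Qed.

(** Choosing the pair by [epsilon] makes it a term, so that pairs can be rewritten; the choice is
    meaningful once the pairing axiom holds. *)
Definition upair (M : set_universe) (x y : M) : M :=
  epsilon (inhabits x) (fun p => is_upair p x y).

Definition pr (M : set_universe) (x y : M) : M := upair (upair x x) (upair x y).

Section Sets.

Context (M : set_universe) (HM : ZFC M).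
Implicit Types x y z X Y f : M.

Lemma upairE x y z : z ∈ upair x y <-> z = x \/ z = y.
Proof.
  revert z. exact (epsilon_spec (inhabits x) _ (zfc_pairing HM x y)).
Qed.

Lemma ext_eq x y : (forall z, z ∈ x <-> z ∈ y) -> x = y.
Proof. exact (zfc_extensionality HM (x := x) (y := y)). Qed.

Lemma is_upairE p x y : is_upair p x y <-> p = upair x y.
Proof.
  split.
  - intros H. apply ext_eq. intros z. rewrite upairE. apply H.
  - intros -> z. apply upairE.
Qed.

Lemma is_opairE p x y : is_opair p x y <-> p = pr x y.
Proof.
  unfold is_opair, pr. split.
  - intros (a & b & Ha & Hb & Hp). apply is_upairE in Ha, Hb, Hp. congruence.
  - intros ->. exists (upair x x), (upair x y). rewrite !is_upairE. auto.
Qed.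

Lemma upair_same x y z : upair x x = upair y z -> x = y /\ x = z.
Proof.
  intros H.
  assert (Hy : y ∈ upair x x) by (rewrite H; apply upairE; auto).
  assert (Hz : z ∈ upair x x) by (rewrite H; apply upairE; auto).
  apply upairE in Hy, Hz. intuition congruence.
Qed.

Lemma pr_inj x y x' y' : pr x y = pr x' y' -> x = x' /\ y = y'.
Proof.
  unfold pr. intros H.
  assert (Hx : x = x').
  { assert (K : upair x x ∈ upair (upair x' x') (upair x' y')) by (rewrite <- H; apply upairE; auto).
    apply upairE in K. destruct K as [K|K]; apply upair_same in K; tauto. }
  subst x'. split; [reflexivity|].
  assert (K : upair x y ∈ upair (upair x x) (upair x y')) by (rewrite <- H; apply upairE; auto).
  assert (K' : upair x y' ∈ upair (upair x x) (upair x y)) by (rewrite H; apply upairE; auto).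
  apply upairE in K, K'. destruct K as [K|K].
  - symmetry in K. apply upair_same in K. destruct K as [_ <-].
    destruct K' as [K'|K']; symmetry in K'; apply upair_same in K'; tauto.
  - assert (L : y ∈ upair x y') by (rewrite <- K; apply upairE; auto).
    assert (L' : y' ∈ upair x y) by (rewrite K; apply upairE; auto).
    apply upairE in L, L'. intuition congruence.
Qed.

Lemma maps_toE f x y : maps_to f x y <-> pr x y ∈ f.
Proof.
  unfold maps_to. split.
  - intros (p & Hp & H). apply is_opairE in Hp. congruence.
  - intros H. exists (pr x y). rewrite is_opairE. auto.
Qed.

Lemma is_functionE f X Y : is_function f X Y <->
  (forall p, p ∈ f -> exists x y, x ∈ X /\ y ∈ Y /\ p = pr x y) /\
  (forall x, x ∈ X -> exists y, pr x y ∈ f) /\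
  (forall x y y', pr x y ∈ f -> pr x y' ∈ f -> y = y').
Proof.
  split.
  - intros [H K]. split; [|split].
    + intros p Hp. destruct (H _ Hp) as (x & y & Hx & Hy & Hxy).
      apply is_opairE in Hxy. eauto.
    + intros x Hx. destruct (K _ Hx) as (y & Hy & _). exists y. apply maps_toE. exact Hy.
    + intros x y y' Hy Hy'. destruct (H _ Hy) as (a & b & Ha & _ & E).
      apply is_opairE in E. apply pr_inj in E. destruct E as [<- <-].
      destruct (K _ Ha) as (c & _ & Hc).
      rewrite <- (Hc y), <- (Hc y'); [reflexivity|apply maps_toE; assumption..].
  - intros (H & K & L). split.
    + intros p Hp. destruct (H _ Hp) as (x & y & Hx & Hy & ->).
      exists x, y. rewrite is_opairE. auto.
    + intros x Hx. destruct (K _ Hx) as [y Hy]. exists y. split.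
      * apply maps_toE. exact Hy.
      * intros y' Hy'. apply maps_toE in Hy'. eauto.
Qed.

Lemma is_function_dom f X Y x y : is_function f X Y -> pr x y ∈ f -> x ∈ X /\ y ∈ Y.
Proof.
  intros (H & _)%is_functionE Hp. destruct (H _ Hp) as (a & b & Ha & Hb & E).
  apply pr_inj in E. destruct E as [-> ->]. auto.
Qed.

Lemma is_function_fun f X Y x y y' :
  is_function f X Y -> pr x y ∈ f -> pr x y' ∈ f -> y = y'.
Proof. intros (_ & _ & H)%is_functionE. apply H. Qed.

Lemma is_function_tot f X Y x : is_function f X Y -> x ∈ X -> exists y, pr x y ∈ f.
Proof. intros (_ & H & _)%is_functionE. apply H. Qed.

Lemma is_function_eq f g X Y Z : is_function f X Y -> is_function g X Z ->
  (forall x y, pr x y ∈ f -> pr x y ∈ g) -> f = g.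
Proof.
  intros Hf Hg H. apply ext_eq. intros p. split; intros Hp.
  - apply is_functionE in Hf as (K & _). destruct (K _ Hp) as (x & y & _ & _ & ->). auto.
  - pose proof Hg as (K & _)%is_functionE. destruct (K _ Hp) as (x & y & Hx & _ & ->).
    destruct (is_function_tot Hf Hx) as [z Hz].
    rewrite (is_function_fun Hg Hp (H _ _ Hz)). exact Hz.
Qed.

(** No formula sees the [epsilon] inside [upair], so its graph is expressed by the membership
    condition of [is_upair]. The renaming by two steps over the bound [z] and the variable for the
    value. *)
Lemma DT_upair (t u : (nat -> M) -> M) : DT t -> DT u -> DT (fun v => upair (t v) (u v)).
Proof.
  intros Ht Hu. unfold DT.
  apply Dfn_ext with (P := fun v => forall z, z ∈ v 0 <-> z = t (shift v) \/ z = u (shift v)).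
  { intros v. rewrite <- is_upairE. reflexivity. }
  repeat first [apply (DT_ren (fun n => S (S n)) Ht)
    | apply (DT_ren (fun n => S (S n)) Hu) | dfn_base].
Qed.

Lemma DT_pr (t u : (nat -> M) -> M) : DT t -> DT u -> DT (fun v => pr (t v) (u v)).
Proof.
  intros Ht Hu. unfold pr. apply DT_upair; apply DT_upair; assumption.
Qed.

End Sets.

Ltac dfn :=
  repeat first
    [ match goal with
      | |- DT (fun v => pr _ _) => apply DT_pr; [assumption| |]
      | |- DT (fun v => upair _ _) => apply DT_upair; [assumption| |]
      end
    | dfn_base ].

(** * Products, natural numbers and least fixed points *)

Section Constructions.

Context (M : set_universe) (HM : ZFC M).
Implicit Types x y z X Y f : M.

Lemma exists_empty : exists e : M, is_empty e.
Proof.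
  destruct (ZFC_inhabited HM) as [a].
  destruct (separation HM (P := fun z => z <> z) a) as [e He]; [dfn|].
  exists e. intros z Hz. apply He in Hz. tauto.
Qed.

Lemma empty_unique x y : is_empty x -> is_empty y -> x = y.
Proof.
  intros Hx Hy. apply (ext_eq HM). intros z. split; intros H; exfalso; firstorder.
Qed.

Lemma exists_union2 x y : exists u : M, forall z, z ∈ u <-> z ∈ x \/ z ∈ y.
Proof.
  destruct (zfc_union HM (upair x y)) as [u Hu]. exists u. intros z. rewrite Hu. split.
  - intros (t & Ht & Hz). apply (upairE HM) in Ht. destruct Ht as [->| ->]; auto.
  - intros [H|H]; [exists x|exists y]; rewrite (upairE HM); auto.
Qed.

Lemma exists_prod X Y :
  exists u : M, forall z, z ∈ u <-> exists x y, x ∈ X /\ y ∈ Y /\ z = pr x y.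
Proof.
  destruct (exists_union2 X Y) as [U HU].
  destruct (zfc_powerset HM U) as [P HP].
  destruct (zfc_powerset HM P) as [Q HQ].
  destruct (separation HM (P := fun z => exists x y, x ∈ X /\ y ∈ Y /\ z = pr x y) Q)
    as [u Hu]; [dfn|].
  exists u. intros z. rewrite Hu. split; [tauto|]. intros H. split; [|exact H].
  destruct H as (x & y & Hx & Hy & ->). apply HQ. intros t Ht. apply HP.
  intros s Hs. apply HU. unfold pr in Ht. apply (upairE HM) in Ht.
  destruct Ht as [->| ->]; apply (upairE HM) in Hs; destruct Hs as [->| ->]; auto.
Qed.

Lemma prod_pr X Y (u : M) x y :
  (forall z, z ∈ u <-> exists x y, x ∈ X /\ y ∈ Y /\ z = pr x y) ->
  (pr x y ∈ u <-> x ∈ X /\ y ∈ Y).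
Proof.
  intros Hu. rewrite Hu. split.
  - intros (a & b & Ha & Hb & E). apply (pr_inj HM) in E. destruct E as [-> ->]. auto.
  - intros [Hx Hy]. exists x, y. auto.
Qed.

Lemma mem_irrefl x : ~ x ∈ x.
Proof.
  intros H. destruct (zfc_foundation HM (x := upair x x)) as (y & Hy & K).
  - exists x. apply (upairE HM). auto.
  - apply (upairE HM) in Hy. assert (y = x) by tauto. subst y.
    apply (K x H). apply (upairE HM). auto.
Qed.

Lemma mem_asym x y : x ∈ y -> ~ y ∈ x.
Proof.
  intros H H'. destruct (zfc_foundation HM (x := upair x y)) as (z & Hz & K).
  - exists x. apply (upairE HM). auto.
  - apply (upairE HM) in Hz. destruct Hz as [->| ->].
    + apply (K y H'). apply (upairE HM). auto.
    + apply (K x H). apply (upairE HM). auto.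
Qed.

Lemma is_succ_inj x y z : is_succ z x -> is_succ z y -> x = y.
Proof.
  intros Hx Hy. assert (Kx : x ∈ z) by (apply Hx; auto).
  assert (Ky : y ∈ z) by (apply Hy; auto).
  apply Hy in Kx. apply Hx in Ky. destruct Kx as [Kx|Kx]; [|exact Kx].
  destruct Ky as [Ky|Ky]; [|symmetry; exact Ky]. destruct (mem_asym Kx Ky).
Qed.

Lemma exists_succ x : exists y : M, is_succ y x.
Proof.
  destruct (exists_union2 x (upair x x)) as [y Hy]. exists y. intros z.
  rewrite Hy, (upairE HM). tauto.
Qed.

Lemma exists_omega : exists w : M, is_omega w.
Proof.
  destruct (zfc_infinity HM) as [I HI].
  destruct (separation HM (P := fun z => forall u, is_inductive u -> z ∈ u) I) as [w Hw].
  { unfold is_inductive, is_empty, is_succ. dfn. }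
  exists w. split.
  - split.
    + destruct HI as [(e & He & K) _]. exists e. split; [exact He|]. apply Hw. split; [exact K|].
      intros u [(e' & He' & K') _]. rewrite (empty_unique He He'). exact K'.
    + intros x Hx. apply Hw in Hx. destruct Hx as [Hx Kx]. destruct HI as [HI0 HI].
      destruct (HI x Hx) as (y & Hy & Ky). exists y. split; [exact Hy|]. apply Hw.
      split; [exact Ky|]. intros u Hu. pose proof (Kx u Hu) as Hxu.
      destruct Hu as [_ Hu]. destruct (Hu x Hxu) as (y' & Hy' & Ky').
      assert (E : y = y') by (apply (ext_eq HM); intros z; rewrite (Hy z), (Hy' z); tauto).
      rewrite E. exact Ky'.
  - intros u Hu z Hz. apply Hw in Hz. destruct Hz as [_ Hz]. auto.
Qed.

(** The members of [w] that are zero or successors form an inductive set, which minimality makes all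
    of [w]. Together with foundation this replaces induction on [w] by descent, which can also be
    carried out in an extension. *)
Lemma omega_inv (w n : M) : is_omega w -> n ∈ w ->
  is_empty n \/ exists m, m ∈ w /\ is_succ n m.
Proof.
  intros [[(e & He & Ke) Hs] Hmin] Hn.
  destruct (separation HM (P := fun n => is_empty n \/ exists m, m ∈ w /\ is_succ n m) w)
    as [u Hu]. { unfold is_empty, is_succ. dfn. }
  cut (n ∈ u); [intros H; apply Hu in H; tauto|].
  apply (Hmin u); [|exact Hn]. split.
  - exists e. rewrite Hu. auto.
  - intros x Hx. apply Hu in Hx. destruct Hx as [Hx _].
    destruct (Hs x Hx) as (y & Hy & Ky). exists y. split; [exact Hy|].
    apply Hu. split; [exact Ky|]. right. eauto.
Qed.

(** The intersection of all closed sets, cut out of the bound [U]. It serves as recursion both for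
    the set of nodes and for the swap of the roots, without any recursion on numbers. *)
Lemma least_fixpoint (U : M) (Base : M -> Prop) (Step : M -> M -> Prop) :
  Dfn (fun v => Base (v 0)) -> Dfn (fun v => Step (v 0) (v 1)) ->
  (forall z, Base z -> z ∈ U) -> (forall x z, x ∈ U -> Step x z -> z ∈ U) ->
  exists W, (forall z, z ∈ W -> z ∈ U) /\ (forall z, Base z -> z ∈ W) /\
    (forall x z, x ∈ W -> Step x z -> z ∈ W) /\
    (forall z, z ∈ W -> Base z \/ exists x, x ∈ W /\ Step x z).
Proof.
  intros DB DS HB HS.
  set (closed := fun S : M => (forall z, Base z -> z ∈ S) /\
    (forall x z, x ∈ S -> Step x z -> z ∈ S)).
  destruct (separation HM (P := fun z => forall S, closed S -> z ∈ S) U) as [W HW].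
  { unfold closed. dfn.
    - exact (Dfn_ren (fun _ => 0) DB).
    - exact (Dfn_ren (fun n => match n with O => 1 | _ => 0 end) DS). }
  assert (CW : closed W).
  { split.
    - intros z Hz. apply HW. split; [auto|]. intros S [CS _]. auto.
    - intros x z Hx Hz. apply HW in Hx. destruct Hx as [Hx Kx]. apply HW.
      split; [eauto|]. intros S HSc. pose proof (Kx S HSc) as Hxs.
      destruct HSc as [_ CS]. eauto. }
  exists W. split; [|split; [|split]].
  - intros z Hz. apply HW in Hz. tauto.
  - apply CW.
  - apply CW.
  - intros z Hz. apply NNPP. intros N.
    (* If [z] were neither a base element nor the result of a step, [W] without [z] would still be
       closed, against the minimality of [W]. *)
    destruct (separation HM (P := fun t => t <> z) W) as [S HS']; [dfn|].
    assert (C : closed S).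
    { split.
      - intros t Ht. apply HS'. split; [apply CW; exact Ht|]. intros ->. tauto.
      - intros x t Hx Ht. apply HS' in Hx. destruct Hx as [Hx _]. apply HS'.
        split; [apply (proj2 CW x); assumption|]. intros ->. apply N. right. eauto. }
    apply HW in Hz. destruct Hz as [_ Hz]. apply Hz in C. apply HS' in C. tauto.
Qed.

End Constructions.

(** * Binary structures *)

(* A binary structure is a set X with a set G of triples (k, (x, y)), read as
   "x and y are related by the relation named k". *)
Definition biniso (M : set_universe) (X G X' G' f : M) : Prop :=
  is_bijection f X X' /\
  forall k x x' y y', pr x y ∈ f -> pr x' y' ∈ f ->
    (pr k (pr x x') ∈ G <-> pr k (pr y y') ∈ G').

Lemma is_bijectionE (M : set_universe) (HM : ZFC M) (f X Y : M) : is_bijection f X Y <->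
  (forall p, p ∈ f -> exists x y, x ∈ X /\ y ∈ Y /\ p = pr x y) /\
  (forall x, x ∈ X -> exists y, pr x y ∈ f) /\
  (forall x y y', pr x y ∈ f -> pr x y' ∈ f -> y = y') /\
  (forall x x' y, pr x y ∈ f -> pr x' y ∈ f -> x = x') /\
  (forall y, y ∈ Y -> exists x, pr x y ∈ f).
Proof.
  unfold is_bijection. rewrite (is_functionE HM). split.
  - intros ((H1 & H2 & H3) & H4 & H5). do 3 (split; [assumption|]). split.
    + intros x x' y Hx Hx'. apply (H4 x x' y); apply (maps_toE HM); assumption.
    + intros y Hy. destruct (H5 y Hy) as [x Hx]. exists x. apply (maps_toE HM). exact Hx.
  - intros (H1 & H2 & H3 & H4 & H5). split; [auto|]. split.
    + intros x x' y Hx Hx'. apply (maps_toE HM) in Hx, Hx'. eauto.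
    + intros y Hy. destruct (H5 y Hy) as [x Hx]. exists x. apply (maps_toE HM). exact Hx.
Qed.

Lemma is_bijection_dom (M : set_universe) (HM : ZFC M) (f X Y x y : M) :
  is_bijection f X Y -> pr x y ∈ f -> x ∈ X /\ y ∈ Y.
Proof. intros [H _]. apply (is_function_dom HM H). Qed.

Lemma exists_relation (M : set_universe) (HM : ZFC M) (X Y : M) (P : M -> M -> Prop) :
  Dfn (fun v => P (v 0) (v 1)) -> (forall x y, P x y -> x ∈ X /\ y ∈ Y) ->
  exists f, (forall x y, pr x y ∈ f <-> P x y) /\
    (forall p, p ∈ f -> exists x y, x ∈ X /\ y ∈ Y /\ p = pr x y).
Proof.
  intros D H. destruct (exists_prod HM X Y) as [U HU].
  destruct (separation HM (P := fun p => exists x y, p = pr x y /\ P x y) U) as [f Hf].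
  { dfn. exact (Dfn_ren (fun n => match n with O => 1 | _ => 0 end) D). }
  exists f. split.
  - intros x y. rewrite Hf. split.
    + intros (_ & x' & y' & E & K). apply (pr_inj HM) in E. destruct E as [-> ->]. exact K.
    + intros K. split; [apply (prod_pr HM _ _ HU); auto|eauto].
  - intros p Hp. apply Hf in Hp. destruct Hp as (_ & x & y & -> & K). exists x, y.
    destruct (H _ _ K). auto.
Qed.

Lemma biniso_inv (M : set_universe) (HM : ZFC M) (X G X' G' f : M) :
  biniso X G X' G' f -> exists g, biniso X' G' X G g /\
    forall x y, pr y x ∈ g <-> pr x y ∈ f.
Proof.
  intros [B R].
  destruct (exists_relation HM (X := X') (Y := X) (P := fun y x => pr x y ∈ f)) as (g & Hg & Kg).
  { dfn. }
  { intros y x H. destruct (is_bijection_dom HM B H). auto. }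
  exists g. split; [|intros x y; apply Hg].
  apply (is_bijectionE HM) in B. destruct B as (_ & B2 & B3 & B4 & B5). split.
  - apply (is_bijectionE HM). split; [exact Kg|]. split; [|split; [|split]].
    + intros y Hy. destruct (B5 y Hy) as [x Hx]. exists x. apply Hg. exact Hx.
    + intros y x x' H H'. apply Hg in H, H'. eauto.
    + intros y y' x H H'. apply Hg in H, H'. eauto.
    + intros x Hx. destruct (B2 x Hx) as [y Hy]. exists y. apply Hg. exact Hy.
  - intros k x x' y y' H H'. apply Hg in H, H'. symmetry. apply R; assumption.
Qed.

(** * The tree of copies *)

(* Every node is a pair whose second component is its label. *)
Definition label (M : set_universe) (v y : M) : Prop := exists u, v = pr u y.

(* The copy with index i below a node labelled y is a copy of XB if i = y, and
   of XA otherwise; so the labels can be read off from the types of the copies. *)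
Definition in_copy (M : set_universe) (XA XB y i x : M) : Prop :=
  (i = y /\ x ∈ XB) \/ (i <> y /\ x ∈ XA).

(* "w is the element x of the copy with index i below v" *)
Definition child (M : set_universe) (E v i x w : M) : Prop := pr (pr v (pr i x)) w ∈ E.

(** An axiomatic description of the nodes: it is realised in [V], transferred to the extension, and
    is then the only source of information about the tree. The relation [rk] makes the child
    relation well-founded in every model, since the rank of a parent is a member of the rank of its
    child. *)
Record tree (M : set_universe) (J XA XB p q W rp rq E rk : M) : Prop := {
  tree_p : p ∈ J;
  tree_q : q ∈ J;
  tree_pq : p <> q;
  tree_rp : rp ∈ W;
  tree_rq : rq ∈ W;
  tree_label_p : label rp p;
  tree_label_q : label rq q;
  tree_label : forall w, w ∈ W -> exists y, y ∈ J /\ label w y;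
  tree_dom : forall v i x w, child E v i x w ->
    v ∈ W /\ w ∈ W /\ i ∈ J /\ exists y, label v y /\ in_copy XA XB y i x;
  tree_label_child : forall v i x w, child E v i x w -> label w x;
  tree_child : forall v i x y, v ∈ W -> i ∈ J -> label v y -> in_copy XA XB y i x ->
    exists w, child E v i x w;
  tree_fun : forall v i x w w', child E v i x w -> child E v i x w' -> w = w';
  tree_inj : forall v i x v' i' x' w, child E v i x w -> child E v' i' x' w ->
    v = v' /\ i = i' /\ x = x';
  tree_root : forall v i x w, child E v i x w -> w <> rp /\ w <> rq;
  tree_inv : forall w, w ∈ W -> w = rp \/ w = rq \/ exists v i x, child E v i x w;
  tree_rank : forall w, w ∈ W -> exists n, pr w n ∈ rk;
  tree_rank_child : forall v i x w m n, child E v i x w ->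
    pr v m ∈ rk -> pr w n ∈ rk -> m ∈ n }.

(* Relations of the tree, named by (p, i) for an index i and by (q, k) for the
   name k of a relation of the copies. *)
Definition tree_rel (M : set_universe) (GA GB p q E k w w' : M) : Prop :=
  (exists i x, k = pr p i /\ child E w i x w') \/
  (exists l v i y x x', k = pr q l /\ child E v i x w /\ child E v i x' w' /\ label v y /\
    ((i = y /\ pr l (pr x x') ∈ GB) \/ (i <> y /\ pr l (pr x x') ∈ GA))).

Lemma label_unique (M : set_universe) (HM : ZFC M) (v y y' : M) :
  label v y -> label v y' -> y = y'.
Proof.
  intros [u ->] [u' E]. apply (pr_inj HM) in E. tauto.
Qed.

Section Tree.

Context (M : set_universe) (HM : ZFC M).
Context (J XA XB GA GB p q W rp rq E rk G : M).
Context (T : tree J XA XB p q W rp rq E rk).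
Context (HG : forall k w w', pr k (pr w w') ∈ G <-> tree_rel GA GB p q E k w w').

(** Foundation of [M] is applied to the set of ranks of counterexamples. As [P] only has to be
    definable over [M], in an extension it may mention maps that are not in [V]. *)
Lemma tree_ind (P : M -> Prop) : Dfn (fun v => P (v 0)) ->
  (forall w, w ∈ W -> (forall v i x, child E v i x w -> P v) -> P w) ->
  forall w, w ∈ W -> P w.
Proof.
  intros D H w Hw. apply NNPP. intros N.
  (* The components of a Kuratowski pair in [rk] lie in the double union of [rk], which therefore
     bounds the ranks. *)
  destruct (zfc_union HM rk) as [U1 H1]. destruct (zfc_union HM U1) as [U2 H2].
  destruct (separation HM (P := fun n => exists w, w ∈ W /\ pr w n ∈ rk /\ ~ P w) U2)
    as [B HB].
  { dfn. exact (Dfn_ren (fun _ => 0) D). }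
  assert (KB : forall n, n ∈ B <-> exists w, w ∈ W /\ pr w n ∈ rk /\ ~ P w).
  { intros n. rewrite HB. split; [tauto|]. intros K. split; [|exact K].
    destruct K as (u & _ & K & _). apply H2. exists (upair u n).
    rewrite (upairE HM). split; [|auto]. apply H1. exists (pr u n). split; [exact K|].
    apply (upairE HM). auto. }
  destruct (zfc_foundation HM (x := B)) as (n & Hn & Kn).
  - destruct (tree_rank T Hw) as [n Hn]. exists n. apply KB. eauto.
  - apply KB in Hn. destruct Hn as (u & Hu & Ku & Nu). apply Nu. apply H; [exact Hu|].
    intros v i x Hc. apply NNPP. intros Nv.
    destruct (tree_dom T Hc) as [Hv _]. destruct (tree_rank T Hv) as [m Hm].
    apply (Kn m (tree_rank_child T Hc Hm Ku)). apply KB. eauto.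
Qed.

Lemma rel_index i v w : pr (pr p i) (pr v w) ∈ G <-> exists x, child E v i x w.
Proof.
  rewrite HG. split.
  - intros [(i' & x & K & H)|(l & v' & i' & y & x & x' & K & _)]; apply (pr_inj HM) in K.
    + destruct K as [_ ->]. eauto.
    + destruct (tree_pq T (proj1 K)).
  - intros [x H]. left. eauto.
Qed.

Lemma rel_copy l v i y x x' w w' : label v y -> child E v i x w -> child E v i x' w' ->
  (pr (pr q l) (pr w w') ∈ G <->
    (i = y /\ pr l (pr x x') ∈ GB) \/ (i <> y /\ pr l (pr x x') ∈ GA)).
Proof.
  intros Hy Hw Hw'. rewrite HG. split.
  - intros [(i0 & x0 & K & _)|(l0 & v0 & i0 & y0 & x0 & x0' & K & H1 & H2 & H3 & H4)];
      apply (pr_inj HM) in K.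
    + destruct (tree_pq T (eq_sym (proj1 K))).
    + destruct K as [_ <-].
      destruct (tree_inj T H1 Hw) as (-> & -> & ->).
      destruct (tree_inj T H2 Hw') as (_ & _ & ->).
      rewrite (label_unique HM H3 Hy) in H4. exact H4.
  - intros H. right. exists l, v, i, y, x, x'. auto.
Qed.

(** The relations named (p, i) force [s] to carry the copy with index [i] below [v] onto the one
    below [v'], and those named (q, k) make the induced map on elements an isomorphism. Keeping the
    two types as [X1], [G1] and [X2], [G2] treats all four combinations at once. *)
Lemma copy_iso s v v' y y' i X1 G1 X2 G2 :
  biniso W G W G s -> pr v v' ∈ s -> i ∈ J -> label v y -> label v' y' ->
  (i = y /\ X1 = XB /\ G1 = GB) \/ (i <> y /\ X1 = XA /\ G1 = GA) ->
  (i = y' /\ X2 = XB /\ G2 = GB) \/ (i <> y' /\ X2 = XA /\ G2 = GA) ->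
  exists f, biniso X1 G1 X2 G2 f.
Proof.
  intros [B R] Hs Hi Hy Hy' C1 C2.
  destruct (is_bijection_dom HM B Hs) as [Hv Hv'].
  apply (is_bijectionE HM) in B. destruct B as (B1 & B2 & B3 & B4 & B5).
  assert (A1 : forall x, in_copy XA XB y i x <-> x ∈ X1).
  { intros x. unfold in_copy. destruct C1 as [(-> & -> & ->)|(K & -> & ->)]; tauto. }
  assert (A2 : forall x, in_copy XA XB y' i x <-> x ∈ X2).
  { intros x. unfold in_copy. destruct C2 as [(-> & -> & ->)|(K & -> & ->)]; tauto. }
  assert (D1 : forall x w, child E v i x w -> x ∈ X1).
  { intros x w H. destruct (tree_dom T H) as (_ & _ & _ & z & Hz & K).
    rewrite (label_unique HM Hz Hy) in K. apply A1. exact K. }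
  assert (D2 : forall x w, child E v' i x w -> x ∈ X2).
  { intros x w H. destruct (tree_dom T H) as (_ & _ & _ & z & Hz & K).
    rewrite (label_unique HM Hz Hy') in K. apply A2. exact K. }
  assert (N : forall w w', pr w w' ∈ s ->
    ((exists x, child E v i x w) <-> exists x', child E v' i x' w')).
  { intros w w' H. rewrite <- !rel_index. apply R; assumption. }
  destruct (exists_relation HM (X := X1) (Y := X2) (P := fun x x' =>
    exists w w', child E v i x w /\ child E v' i x' w' /\ pr w w' ∈ s)) as (f & Hf & Kf).
  { unfold child. dfn. }
  { intros x x' (w & w' & H & H' & _). eauto. }
  exists f. split.
  - apply (is_bijectionE HM). split; [exact Kf|]. split; [|split; [|split]].
    + intros x Hx. destruct (tree_child T Hv Hi Hy (proj2 (A1 x) Hx)) as [w Hw].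
      destruct (tree_dom T Hw) as (_ & Ww & _). destruct (B2 w Ww) as [w' Hw'].
      destruct (proj1 (N w w' Hw')) as [x' Hx']; [eauto|].
      exists x'. apply Hf. eauto.
    + intros x x1 x2 H1 H2. apply Hf in H1, H2.
      destruct H1 as (w1 & w1' & H1 & H1' & K1). destruct H2 as (w2 & w2' & H2 & H2' & K2).
      rewrite (tree_fun T H1 H2) in K1. rewrite (B3 _ _ _ K1 K2) in H1'.
      destruct (tree_inj T H1' H2') as (_ & _ & ->). reflexivity.
    + intros x1 x2 x H1 H2. apply Hf in H1, H2.
      destruct H1 as (w1 & w1' & H1 & H1' & K1). destruct H2 as (w2 & w2' & H2 & H2' & K2).
      rewrite (tree_fun T H1' H2') in K1. rewrite (B4 _ _ _ K1 K2) in H1.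
      destruct (tree_inj T H1 H2) as (_ & _ & ->). reflexivity.
    + intros x' Hx'. destruct (tree_child T Hv' Hi Hy' (proj2 (A2 x') Hx')) as [w' Hw'].
      destruct (tree_dom T Hw') as (_ & Ww & _). destruct (B5 w' Ww) as [w Hw].
      destruct (proj2 (N w w' Hw)) as [x Hx]; [eauto|].
      exists x. apply Hf. eauto.
  - intros k x1 x2 x1' x2' H1 H2. apply Hf in H1, H2.
    destruct H1 as (w1 & w1' & H1 & H1' & K1). destruct H2 as (w2 & w2' & H2 & H2' & K2).
    pose proof (R (pr q k) _ _ _ _ K1 K2) as K.
    rewrite (rel_copy k Hy H1 H2), (rel_copy k Hy' H1' H2') in K.
    destruct C1 as [(-> & -> & ->)|(E1 & -> & ->)];
      destruct C2 as [(E2 & -> & ->)|(E2 & -> & ->)]; tauto.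
Qed.

(** If the labels differed, the copy with index [y] would have the type of [XB] below [v] and that
    of [XA] below [v'], and [copy_iso] would give an isomorphism between them. *)
Lemma label_preserved s v v' y y' : ~ (exists f, biniso XA GA XB GB f) ->
  biniso W G W G s -> pr v v' ∈ s -> label v y -> label v' y' -> y = y'.
Proof.
  intros N Hs H Hy Hy'. apply NNPP. intros Ne.
  destruct (is_bijection_dom HM (proj1 Hs) H) as [Hv _].
  destruct (tree_label T Hv) as (z & Hz & Kz). rewrite (label_unique HM Kz Hy) in Hz.
  destruct (@copy_iso s v v' y y' y XB GB XA GA) as [f Hf]; try assumption.
  - auto.
  - auto.
  - destruct (biniso_inv HM Hf) as (g & Hg & _). eauto.
Qed.

Lemma tree_rigid s : ~ (exists f, biniso XA GA XB GB f) -> biniso W G W G s ->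
  forall w, w ∈ W -> pr w w ∈ s.
Proof.
  intros N Hs.
  pose proof (proj1 Hs) as B. apply (is_bijectionE HM) in B.
  destruct B as (_ & B2 & B3 & B4 & B5).
  (* A node without parent goes to a node without parent and with the same label; the labels [p] and
     [q] then tell the two roots apart. *)
  assert (Root : forall r y, r ∈ W -> label r y -> (forall v i x, ~ child E v i x r) ->
    forall r', pr r r' ∈ s -> label r' y /\ (forall v i x, ~ child E v i x r')).
  { intros r y Hr Hy Nr r' H.
    destruct (is_bijection_dom HM (proj1 Hs) H) as [_ Hr'].
    split.
    - destruct (tree_label T Hr') as (y' & _ & Hy').
      rewrite (label_preserved N Hs H Hy Hy'). exact Hy'.
    - intros v' i x Hc. destruct (tree_dom T Hc) as [Hv' _].
      destruct (B5 v' Hv') as [v Hv].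
      destruct (proj1 (rel_index i v r)) as [x0 Hx0]; [|destruct (Nr _ _ _ Hx0)].
      apply (proj2 Hs (pr p i) v r v' r' Hv H). apply rel_index. eauto. }
  assert (Rp : forall v i x, ~ child E v i x rp)
    by (intros v i x Hc; destruct (tree_root T Hc); auto).
  assert (Rq : forall v i x, ~ child E v i x rq)
    by (intros v i x Hc; destruct (tree_root T Hc); auto).
  apply tree_ind; [dfn|]. intros w Hw IH. destruct (B2 w Hw) as [w' H].
  destruct (is_bijection_dom HM (proj1 Hs) H) as [_ Hw'].
  destruct (tree_inv T Hw) as [->|[->|(v & i & x & Hc)]].
  - destruct (Root rp p Hw (tree_label_p T) Rp w' H) as [L K].
    destruct (tree_inv T Hw') as [->|[->|(v & i & x & Hc)]]; [exact H| |destruct (K _ _ _ Hc)].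
    destruct (tree_pq T (label_unique HM L (tree_label_q T))).
  - destruct (Root rq q Hw (tree_label_q T) Rq w' H) as [L K].
    destruct (tree_inv T Hw') as [->|[->|(v & i & x & Hc)]]; [|exact H|destruct (K _ _ _ Hc)].
    destruct (tree_pq T (label_unique HM (tree_label_p T) L)).
  - pose proof (IH _ _ _ Hc) as Hv.
    destruct (proj1 (rel_index i v w')) as [x' Hx'].
    { apply (proj2 Hs (pr p i) v w v w' Hv H). apply rel_index. eauto. }
    (* The label of a child is the element for which it stands, so preservation of labels leaves no
       freedom inside a copy. *)
    assert (K : x = x') by
      exact (label_preserved N Hs H (tree_label_child T Hc) (tree_label_child T Hx')).
    subst x'. rewrite (tree_fun T Hx' Hc) in H. exact H.
Qed.

(** * The exchange of the roots along an isomorphism *)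

Section Swap.

Context (f : M) (Hf : biniso XA GA XB GB f).

(** The four cases are B to B, A to A, B to A and A to B, for the copies with index [i] below nodes
    labelled [y] and [y']. In relational form, reversing the direction only exchanges the last two
    cases. *)
Definition transfer (y y' i x x' : M) : Prop :=
  (i = y /\ i = y' /\ x = x' /\ x ∈ XB) \/ (i <> y /\ i <> y' /\ x = x' /\ x ∈ XA) \/
  (i = y /\ i <> y' /\ pr x' x ∈ f) \/ (i <> y /\ i = y' /\ pr x x' ∈ f).

Lemma transfer_sym y y' i x x' : transfer y y' i x x' -> transfer y' y i x' x.
Proof.
  unfold transfer.
  intros [(H1 & H2 & -> & H)|[(H1 & H2 & -> & H)|[(H1 & H2 & H)|(H1 & H2 & H)]]]; tauto.
Qed.

Lemma transfer_dom y y' i x x' : transfer y y' i x x' -> in_copy XA XB y i x.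
Proof.
  unfold in_copy.
  intros [(H1 & H2 & -> & H)|[(H1 & H2 & -> & H)|[(H1 & H2 & H)|(H1 & H2 & H)]]];
    try destruct (is_bijection_dom HM (proj1 Hf) H); tauto.
Qed.

Lemma transfer_tot y y' i x : in_copy XA XB y i x -> exists x', transfer y y' i x x'.
Proof.
  destruct Hf as [B _]. apply (is_bijectionE HM) in B. destruct B as (_ & B2 & _ & _ & B5).
  unfold transfer. intros [[K H]|[K H]]; destruct (classic (i = y')) as [L|L].
  - exists x. tauto.
  - destruct (B5 x H) as [x' Hx']. exists x'. tauto.
  - destruct (B2 x H) as [x' Hx']. exists x'. tauto.
  - exists x. tauto.
Qed.

Lemma transfer_fun y y' i x x1 x2 :
  transfer y y' i x x1 -> transfer y y' i x x2 -> x1 = x2.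
Proof.
  destruct Hf as [B _]. apply (is_bijectionE HM) in B. destruct B as (_ & _ & B3 & B4 & _).
  unfold transfer.
  intros [(H1 & H2 & H3 & H)|[(H1 & H2 & H3 & H)|[(H1 & H2 & H)|(H1 & H2 & H)]]]
    [(K1 & K2 & K3 & K)|[(K1 & K2 & K3 & K)|[(K1 & K2 & K)|(K1 & K2 & K)]]];
    try (exfalso; tauto); try congruence; eauto.
Qed.

Lemma transfer_rel y y' i k x1 x2 x1' x2' :
  transfer y y' i x1 x1' -> transfer y y' i x2 x2' ->
  (i = y /\ pr k (pr x1 x2) ∈ GB) \/ (i <> y /\ pr k (pr x1 x2) ∈ GA) ->
  (i = y' /\ pr k (pr x1' x2') ∈ GB) \/ (i <> y' /\ pr k (pr x1' x2') ∈ GA).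
Proof.
  destruct Hf as [_ R]. unfold transfer.
  intros [(H1 & H2 & H3 & H)|[(H1 & H2 & H3 & H)|[(H1 & H2 & H)|(H1 & H2 & H)]]]
    [(K1 & K2 & K3 & K)|[(K1 & K2 & K3 & K)|[(K1 & K2 & K)|(K1 & K2 & K)]]];
    try (exfalso; tauto); subst x1' x2' || pose proof (R k _ _ _ _ H K); tauto.
Qed.

(* The recursion that swaps the roots and follows [transfer] from each copy to
   its image. *)
Lemma exists_swap : exists s, pr rp rq ∈ s /\
  (forall v v' y y' i x x' w w', pr v v' ∈ s -> label v y -> label v' y' ->
     transfer y y' i x x' -> child E v i x w -> child E v' i x' w' -> pr w w' ∈ s) /\
  (forall w w', pr w w' ∈ s -> pr w' w ∈ s) /\
  (forall t, t ∈ s -> exists w w', w ∈ W /\ w' ∈ W /\ t = pr w w') /\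
  (forall w w', pr w w' ∈ s -> (w = rp /\ w' = rq) \/ (w = rq /\ w' = rp) \/
     exists v v' y y' i x x', pr v v' ∈ s /\ label v y /\ label v' y' /\
       transfer y y' i x x' /\ child E v i x w /\ child E v' i x' w').
Proof.
  destruct (exists_prod HM W W) as [U HU].
  destruct (least_fixpoint HM (U := U)
    (* Starting from both ordered pairs of roots makes the relation symmetric. *)
    (Base := fun t => t = pr rp rq \/ t = pr rq rp)
    (Step := fun t t' => exists v v' y y' i x x' w w', t = pr v v' /\ t' = pr w w' /\
       label v y /\ label v' y' /\ transfer y y' i x x' /\
       child E v i x w /\ child E v' i x' w')) as (s & S1 & S2 & S3 & S4).
  - dfn.
  - unfold label, transfer, child. dfn.
  - intros z [->| ->]; apply (prod_pr HM _ _ HU); split;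
      apply (tree_rp T) || apply (tree_rq T).
  - intros t t' _ (v & v' & y & y' & i & x & x' & w & w' & _ & -> & _ & _ & _ & H & H').
    apply (prod_pr HM _ _ HU). split; eapply (tree_dom T); eassumption.
  - assert (C : forall v v' y y' i x x' w w', pr v v' ∈ s -> label v y -> label v' y' ->
      transfer y y' i x x' -> child E v i x w -> child E v' i x' w' -> pr w w' ∈ s).
    { intros v v' y y' i x x' w w' H Hy Hy' Ht Hc Hc'. apply (S3 _ (pr w w') H).
      exists v, v', y, y', i, x, x', w, w'. auto 8. }
    assert (I : forall w w', pr w w' ∈ s -> (w = rp /\ w' = rq) \/ (w = rq /\ w' = rp) \/
      exists v v' y y' i x x', pr v v' ∈ s /\ label v y /\ label v' y' /\
        transfer y y' i x x' /\ child E v i x w /\ child E v' i x' w').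
    { intros w w' H. destruct (S4 _ H) as [[K|K]|(t & Ht & v & v' & y & y' & i & x & x' & w0 &
        w0' & -> & K & H1 & H2 & H3 & H4 & H5)]; apply (pr_inj HM) in K; destruct K as [-> ->].
      - auto.
      - auto.
      - right. right. exists v, v', y, y', i, x, x'. auto 8. }
    exists s. split; [auto|]. split; [exact C|]. split; [|split; [|exact I]].
    + assert (K : forall w, w ∈ W -> forall w', pr w w' ∈ s -> pr w' w ∈ s).
      { apply (tree_ind (P := fun w => forall w', pr w w' ∈ s -> pr w' w ∈ s)); [dfn|].
        intros w Hw IH w' H.
        destruct (I w w' H) as [[-> ->]|[[-> ->]|(v & v' & y & y' & i & x & x' &
          H1 & H2 & H3 & H4 & H5 & H6)]]; auto.
        apply (C v' v y' y i x' x); auto.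
        - exact (IH _ _ _ H5 _ H1).
        - apply transfer_sym. exact H4. }
      intros w w' H. apply (K w); [|exact H].
      apply S1 in H. apply (prod_pr HM _ _ HU) in H. tauto.
    + intros t Ht. apply HU. apply S1. exact Ht.
Qed.

(** The swap is an involution. By its symmetry, injectivity and surjectivity follow from
    single-valuedness and totality, which are proved by induction along the tree, and preservation
    of relations in one direction gives the other. *)
Lemma tree_not_rigid : exists s, biniso W G W G s /\ exists w, w ∈ W /\ ~ pr w w ∈ s.
Proof.
  destruct exists_swap as (s & S1 & C & Sym & Dom & I).
  assert (Tot : forall w, w ∈ W -> exists w', pr w w' ∈ s).
  { apply tree_ind; [dfn|]. intros w Hw IH.
    destruct (tree_inv T Hw) as [->|[->|(v & i & x & Hc)]]; [eauto|eauto|].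
    destruct (IH _ _ _ Hc) as [v' Hv'].
    destruct (tree_dom T Hc) as (_ & _ & Hi & y & Hy & Hx).
    destruct (Dom _ Hv') as (a & b & _ & Hb & K). apply (pr_inj HM) in K.
    destruct K as [<- <-]. destruct (tree_label T Hb) as (y' & _ & Hy').
    destruct (transfer_tot y' Hx) as [x' Hx'].
    destruct (tree_child T Hb Hi Hy' (transfer_dom (transfer_sym Hx'))) as [w' Hw'].
    exists w'. eapply C; eassumption. }
  assert (Inv : forall v i x w w', child E v i x w -> pr w w' ∈ s ->
    exists v' y y' x', pr v v' ∈ s /\ label v y /\ label v' y' /\
      transfer y y' i x x' /\ child E v' i x' w').
  { intros v i x w w' Hc H.
    destruct (I _ _ H) as [[-> _]|[[-> _]|(v0 & v' & y & y' & i0 & x0 & x' &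
      H1 & H2 & H3 & H4 & H5 & H6)]].
    - destruct (tree_root T Hc). congruence.
    - destruct (tree_root T Hc). congruence.
    - destruct (tree_inj T Hc H5) as (<- & <- & <-). exists v', y, y', x'. auto. }
  assert (Fun : forall w, w ∈ W -> forall w1 w2, pr w w1 ∈ s -> pr w w2 ∈ s -> w1 = w2).
  { assert (Rt : forall w1, pr rp w1 ∈ s -> w1 = rq).
    { intros w1 H. destruct (I _ _ H) as [[_ K]|[[K _]|(v & v' & y & y' & i & x & x' &
        _ & _ & _ & _ & K & _)]]; [exact K| |destruct (tree_root T K); congruence].
      pose proof (tree_label_p T) as L. rewrite K in L.
      destruct (tree_pq T (label_unique HM L (tree_label_q T))). }
    assert (Rt' : forall w1, pr rq w1 ∈ s -> w1 = rp).
    { intros w1 H. destruct (I _ _ H) as [[K _]|[[_ K]|(v & v' & y & y' & i & x & x' &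
        _ & _ & _ & _ & K & _)]]; [|exact K|destruct (tree_root T K); congruence].
      pose proof (tree_label_q T) as L. rewrite K in L.
      destruct (tree_pq T (label_unique HM (tree_label_p T) L)). }
    apply (tree_ind (P := fun w => forall w1 w2, pr w w1 ∈ s -> pr w w2 ∈ s -> w1 = w2)); [dfn|].
    intros w Hw IH w1 w2 H1 H2.
    destruct (tree_inv T Hw) as [->|[->|(v & i & x & Hc)]].
    - rewrite (Rt _ H1), (Rt _ H2). reflexivity.
    - rewrite (Rt' _ H1), (Rt' _ H2). reflexivity.
    - destruct (Inv _ _ _ _ _ Hc H1) as (v1 & y1 & y1' & x1 & K1 & K2 & K3 & K4 & K5).
      destruct (Inv _ _ _ _ _ Hc H2) as (v2 & y2 & y2' & x2 & L1 & L2 & L3 & L4 & L5).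
      pose proof (IH _ _ _ Hc _ _ K1 L1) as <-.
      rewrite (label_unique HM L2 K2), (label_unique HM L3 K3) in L4.
      rewrite <- (transfer_fun K4 L4) in L5. exact (tree_fun T K5 L5). }
  assert (Fun' : forall w w1 w2, pr w w1 ∈ s -> pr w w2 ∈ s -> w1 = w2).
  { intros w w1 w2 H. destruct (Dom _ H) as (a & b & Ha & _ & K).
    apply (pr_inj HM) in K. destruct K as [<- _]. revert H. apply Fun. exact Ha. }
  assert (Rel : forall k w1 w2 z1 z2, pr w1 z1 ∈ s -> pr w2 z2 ∈ s ->
    tree_rel GA GB p q E k w1 w2 -> tree_rel GA GB p q E k z1 z2).
  { intros k w1 w2 z1 z2 H1 H2
      [(i & x & -> & H)|(l & v & i & y & x1 & x2 & -> & C1 & C2 & Hy & H)].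
    - left. destruct (Inv _ _ _ _ _ H H2) as (v' & y & y' & x' & K1 & _ & _ & _ & K5).
      rewrite (Fun' _ _ _ K1 H1) in K5. eauto.
    - right. destruct (Inv _ _ _ _ _ C1 H1) as (v1 & y1 & y1' & x1' & K1 & K2 & K3 & K4 & K5).
      destruct (Inv _ _ _ _ _ C2 H2) as (v2 & y2 & y2' & x2' & L1 & L2 & L3 & L4 & L5).
      pose proof (Fun' _ _ _ K1 L1) as <-.
      rewrite (label_unique HM L2 Hy), (label_unique HM L3 K3) in L4.
      rewrite (label_unique HM K2 Hy) in K4.
      exists l, v1, i, y1', x1', x2'. do 4 (split; [auto|]). exact (transfer_rel K4 L4 H). }
  exists s. split; [split|].
  - apply (is_bijectionE HM). split; [exact Dom|]. split; [exact Tot|].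
    split; [exact Fun'|]. split.
    + intros w w' z H H'. apply Sym in H, H'. eauto.
    + intros w' Hw'. destruct (Tot w' Hw') as [w Hw]. exists w. auto.
  - intros k w1 w2 z1 z2 H1 H2. rewrite !HG. split; apply Rel; auto.
  (* The root [rp] is moved: its image is [rq], and the two have different labels. *)
  - exists rp. split; [apply (tree_rp T)|]. intros H.
    pose proof (Fun' _ _ _ H S1) as K. pose proof (tree_label_q T) as L.
    rewrite <- K in L. exact (tree_pq T (label_unique HM (tree_label_p T) L)).
Qed.

End Swap.

(** Both sides are evaluated in [M]. Applied to the image of one fixed tree in each extension, this
    decides isomorphism in the sense of that extension. *)
Lemma tree_rigid_iff : (exists f, biniso XA GA XB GB f) <->
  exists s, biniso W G W G s /\ exists w, w ∈ W /\ ~ pr w w ∈ s.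
Proof.
  split.
  - intros [f Hf]. exact (tree_not_rigid Hf).
  - intros (s & Hs & w & Hw & N). apply NNPP. intros K.
    exact (N (tree_rigid K Hs Hw)).
Qed.

End Tree.

(* The nodes are the pairs (u, y) of a finite sequence u, listing the steps that
   lead to the node, and of a label y. The element x of the copy with index i
   below (u, y) is (u', x), where u' is u followed by (y, (i, x)). *)
Lemma exists_tree (M : set_universe) (HM : ZFC M) (J XA XB p q : M) :
  p ∈ J -> q ∈ J -> p <> q -> subset XA J -> subset XB J ->
  exists W rp rq E rk, tree J XA XB p q W rp rq E rk.
Proof.
  intros Hp Hq Hpq HA HB.
  (* An inductive set supplies the lengths: it contains zero and is closed under successor, which is
     what adding a step requires. *)
  destruct (zfc_infinity HM) as [I [(e & He & Ie) HI]].
  destruct (exists_prod HM J J) as [JJ HJJ].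
  destruct (exists_prod HM J JJ) as [A HA'].
  destruct (exists_prod HM I A) as [IA HIA].
  destruct (zfc_powerset HM IA) as [S HS].
  destruct (exists_prod HM S J) as [SJ HSJ].
  (* The domain [d] of the sequence [u] is both its length and the position of the next entry. *)
  set (wdom := fun u d : M => forall m, m ∈ d <-> exists z, pr m z ∈ u).
  assert (wdom_fun : forall u d d', wdom u d -> wdom u d' -> d = d').
  { intros u d d' H H'. apply (ext_eq HM). intros m. rewrite (H m), (H' m). tauto. }
  destruct (separation HM (P := fun v => exists u y d, v = pr u y /\ d ∈ I /\ wdom u d) SJ)
    as [U HU]. { unfold wdom. dfn. }
  set (ch := fun v i x w => exists u y d u', v = pr u y /\ w = pr u' x /\ wdom u d /\
    (forall t, t ∈ u' <-> t ∈ u \/ t = pr d (pr y (pr i x))) /\ i ∈ J /\ in_copy XA XB y i x).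
  assert (in_copy_J : forall y i x, in_copy XA XB y i x -> x ∈ J).
  { intros y i x [[_ H]|[_ H]]; auto. }
  assert (wdom_succ : forall u d u' z, wdom u d -> (forall t, t ∈ u' <-> t ∈ u \/ t = pr d z) ->
    forall d', is_succ d' d <-> wdom u' d').
  { intros u d u' z Hd Hu'.
    assert (K : forall m, (exists z, pr m z ∈ u') <-> m ∈ d \/ m = d).
    { intros m. rewrite (Hd m). split.
      - intros [t Ht]. apply Hu' in Ht. destruct Ht as [Ht|Ht]; [eauto|].
        apply (pr_inj HM) in Ht. tauto.
      - intros [[t Ht]| ->]; [exists t|exists z]; apply Hu'; auto. }
    intros d'. split; intros H m.
    - rewrite K. apply H.
    - rewrite <- K. apply H. }
  destruct (least_fixpoint HM (U := U) (Base := fun v => v = pr e p \/ v = pr e q)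
    (Step := fun v w => exists i x, ch v i x w)) as (W & W1 & W2 & W3 & W4).
  - dfn.
  - unfold ch, wdom, in_copy. dfn.
  - assert (Hw : wdom e e).
    { intros m. split; [intros H; destruct (He _ H)|intros [z H]; destruct (He _ H)]. }
    assert (Hs : e ∈ S) by (apply HS; intros t Ht; destruct (He _ Ht)).
    intros z [->| ->]; apply HU; (split; [apply (prod_pr HM _ _ HSJ); auto|]); eauto 8.
  - intros v w Hv (i & x & u & y & d & u' & -> & -> & Hd & Hu' & Hi & Hx).
    apply HU in Hv. destruct Hv as [Hv (u0 & y0 & d0 & K & Id & Hd0)].
    apply (pr_inj HM) in K. destruct K as [<- <-].
    rewrite <- (wdom_fun _ _ _ Hd Hd0) in Id.
    apply (prod_pr HM _ _ HSJ) in Hv. destruct Hv as [Hu Hy].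
    apply HU. split.
    + apply (prod_pr HM _ _ HSJ). split; [|eauto]. apply HS. intros t Ht. apply Hu' in Ht.
      destruct Ht as [Ht| ->]; [apply HS in Hu; auto|].
      apply (prod_pr HM _ _ HIA). split; [exact Id|].
      apply (prod_pr HM _ _ HA'). split; [exact Hy|].
      apply (prod_pr HM _ _ HJJ). eauto.
    + destruct (HI d Id) as (d' & Hd' & Id'). exists u', x, d'. split; [reflexivity|].
      split; [exact Id'|]. apply (wdom_succ _ _ _ _ Hd Hu'). exact Hd'.
  - assert (WU : forall v, v ∈ W -> exists u y d, v = pr u y /\ y ∈ J /\ d ∈ I /\ wdom u d).
    { intros v Hv. apply W1, HU in Hv. destruct Hv as [Hv (u & y & d & -> & Hd & K)].
      apply (prod_pr HM _ _ HSJ) in Hv. exists u, y, d. tauto. }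
    destruct (exists_prod HM W JJ) as [WJ HWJ].
    destruct (exists_relation HM (X := WJ) (Y := W)
      (P := fun a w => exists v i x, a = pr v (pr i x) /\ v ∈ W /\ ch v i x w)) as (E & HE & _).
    { unfold ch, wdom, in_copy. dfn. }
    { intros a w (v & i & x & -> & Hv & Hc). split; [|apply (W3 v); eauto].
      apply (prod_pr HM _ _ HWJ). split; [exact Hv|]. apply (prod_pr HM _ _ HJJ).
      destruct Hc as (u & y & d & u' & _ & _ & _ & _ & Hi & Hx). eauto. }
    (* The length of its sequence is the rank of a node. *)
    destruct (exists_relation HM (X := W) (Y := I)
      (P := fun v d => v ∈ W /\ d ∈ I /\ exists u y, v = pr u y /\ wdom u d)) as (rk & Hrk & _).
    { unfold wdom. dfn. }
    { tauto. }
    assert (Hc : forall v i x w, child E v i x w <-> v ∈ W /\ ch v i x w).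
    { intros v i x w. unfold child. rewrite HE. split.
      - intros (v' & i' & x' & K & H). apply (pr_inj HM) in K. destruct K as [<- K].
        apply (pr_inj HM) in K. destruct K as [<- <-]. exact H.
      - intros H. exists v, i, x. auto. }
    exists W, (pr e p), (pr e q), E, rk. split; try assumption.
    + auto.
    + auto.
    + exists e. reflexivity.
    + exists e. reflexivity.
    + intros v Hv. destruct (WU v Hv) as (u & y & d & -> & Hy & _). exists y.
      split; [exact Hy|]. exists u. reflexivity.
    + intros v i x w H. apply Hc in H. destruct H as [Hv H]. split; [exact Hv|].
      split; [apply (W3 v); eauto|].
      destruct H as (u & y & d & u' & -> & _ & _ & _ & Hi & Hx).
      split; [exact Hi|]. exists y. split; [exists u; reflexivity|exact Hx].
    + intros v i x w H. apply Hc in H.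
      destruct H as (_ & u & y & d & u' & _ & -> & _). exists u'. reflexivity.
    + intros v i x y Hv Hi [u0 ->] Hx. destruct (WU _ Hv) as (u & y' & d & K & Hy & _ & Hd).
      apply (pr_inj HM) in K. destruct K as [<- <-].
      destruct (exists_union2 HM u0 (upair (pr d (pr y (pr i x))) (pr d (pr y (pr i x)))))
        as [u' Hu'].
      exists (pr u' x). apply Hc. split; [exact Hv|]. exists u0, y, d, u'.
      do 3 (split; [auto|]). split; [|auto].
      intros t. rewrite Hu', (upairE HM). tauto.
    + intros v i x w w' H H'. apply Hc in H, H'.
      destruct H as (_ & u & y & d & u' & -> & -> & Hd & Hu & _).
      destruct H' as (_ & u0 & y0 & d0 & u0' & K & -> & Hd0 & Hu0 & _).
      apply (pr_inj HM) in K. destruct K as [<- <-].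
      rewrite <- (wdom_fun _ _ _ Hd Hd0) in Hu0. f_equal. apply (ext_eq HM).
      intros t. rewrite Hu, Hu0. tauto.
    + intros v i x v' i' x' w H H'. apply Hc in H, H'.
      destruct H as (_ & u & y & d & u' & -> & -> & Hd & Hu & _).
      destruct H' as (_ & u0 & y0 & d0 & u0' & -> & K & Hd0 & Hu0 & _).
      apply (pr_inj HM) in K. destruct K as [<- <-].
      (* Both parents have the same length: the domain of [u'] is the successor of [d] and of
         [d0]. *)
      destruct (exists_succ HM d) as [c Hsc].
      assert (d = d0).
      { apply (is_succ_inj HM Hsc). apply (wdom_succ _ _ _ _ Hd0 Hu0).
        apply (wdom_succ _ _ _ _ Hd Hu). exact Hsc. }
      subst d0.
      (* Position [d] is free in a sequence of length [d], because [d] is not a member of itself. So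
         the entry of [u'] at [d] is the last step, and removing it gives back the sequence of the
         parent. *)
      assert (N : forall u z, wdom u d -> ~ pr d z ∈ u).
      { intros a z Ha Hz. apply (@mem_irrefl _ HM d). apply Ha. eauto. }
      assert (L : pr d (pr y (pr i x)) = pr d (pr y0 (pr i' x))).
      { assert (K : pr d (pr y (pr i x)) ∈ u') by (apply Hu; auto). apply Hu0 in K.
        destruct K as [K|K]; [destruct (N _ _ Hd0 K)|exact K]. }
      pose proof L as K. apply (pr_inj HM) in K. destruct K as [_ K].
      apply (pr_inj HM) in K. destruct K as [<- K]. apply (pr_inj HM) in K.
      destruct K as [<- _]. split; [|auto]. f_equal. apply (ext_eq HM). intros t.
      split; intros Ht.
      * assert (K : t ∈ u') by (apply Hu; auto). apply Hu0 in K.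
        destruct K as [K| ->]; [exact K|]. destruct (N _ _ Hd Ht).
      * assert (K : t ∈ u') by (apply Hu0; auto). apply Hu in K.
        destruct K as [K| ->]; [exact K|]. destruct (N _ _ Hd0 Ht).
    + intros v i x w H. apply Hc in H.
      destruct H as (_ & u & y & d & u' & -> & -> & Hd & Hu & _).
      split; intros K; apply (pr_inj HM) in K; destruct K as [-> _];
        apply (He (pr d (pr y (pr i x)))); apply Hu; auto.
    + intros w Hw. destruct (W4 w Hw) as [[K|K]|(v & Hv & i & x & H)]; [auto|auto|].
      right. right. exists v, i, x. apply Hc. auto.
    + intros v Hv. destruct (WU v Hv) as (u & y & d & -> & _ & Id & Hd). exists d.
      apply Hrk. split; [exact Hv|]. split; [exact Id|]. eauto.
    + intros v i x w m n H Hm Hn. apply Hc in H. apply Hrk in Hm, Hn.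
      destruct H as (_ & u & y & d & u' & -> & -> & Hd & Hu & _).
      destruct Hm as (_ & _ & u1 & y1 & K & Hm). apply (pr_inj HM) in K. destruct K as [<- <-].
      destruct Hn as (_ & _ & u2 & y2 & K & Hn). apply (pr_inj HM) in K. destruct K as [<- <-].
      rewrite (wdom_fun _ _ _ Hm Hd). apply (wdom_succ _ _ _ _ Hd Hu) in Hn.
      apply Hn. auto.
Qed.

(** * Absoluteness *)

Section Extension.

Context (V V' : set_universe) (HV : ZFC V) (HV' : ZFC V') (j : extension V V').

Lemma incl_in x y : j x ∈ j y <-> x ∈ y.
Proof. symmetry. apply incl_mem. Qed.

Lemma incl_elt (y' : V') (x : V) : y' ∈ j x -> exists y, y' = j y /\ y ∈ x.
Proof.
  intros H. destruct (incl_trans H) as [y ->]. exists y. split; [reflexivity|].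
  apply incl_in. exact H.
Qed.

Lemma incl_upair x y : j (upair x y) = upair (j x) (j y).
Proof.
  apply (ext_eq HV'). intros z. rewrite (upairE HV'). split.
  - intros H. apply incl_elt in H. destruct H as (t & -> & H).
    apply (upairE HV) in H. destruct H as [->| ->]; auto.
  - intros [->| ->]; apply incl_in, (upairE HV); auto.
Qed.

Lemma incl_pr x y : j (pr x y) = pr (j x) (j y).
Proof. unfold pr. rewrite !incl_upair. reflexivity. Qed.

(** The components of a pair lie two levels below it, so transitivity of [V] reaches them. *)
Lemma incl_pr_inv (a : V) (x' y' : V') : j a = pr x' y' ->
  exists x y, a = pr x y /\ x' = j x /\ y' = j y.
Proof.
  intros E.
  assert (H : upair x' y' ∈ j a) by (rewrite E; apply (upairE HV'); auto).
  apply incl_elt in H. destruct H as (c & Ec & _).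
  assert (Hx : x' ∈ j c) by (rewrite <- Ec; apply (upairE HV'); auto).
  assert (Hy : y' ∈ j c) by (rewrite <- Ec; apply (upairE HV'); auto).
  apply incl_elt in Hx, Hy. destruct Hx as (x & -> & _). destruct Hy as (y & -> & _).
  exists x, y. split; [|auto]. apply (incl_inj (e := j)). rewrite E, incl_pr. reflexivity.
Qed.

Lemma incl_pr_in (f : V) (x' y' : V') : pr x' y' ∈ j f <->
  exists x y, x' = j x /\ y' = j y /\ pr x y ∈ f.
Proof.
  split.
  - intros H. destruct (incl_elt H) as (a & E & Ha). symmetry in E.
    destruct (incl_pr_inv E) as (x & y & -> & -> & ->). eauto.
  - intros (x & y & -> & -> & H). rewrite <- incl_pr. apply incl_in. exact H.
Qed.

Lemma incl_pr2_in (f : V) (k' x' y' : V') : pr k' (pr x' y') ∈ j f <->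
  exists k x y, k' = j k /\ x' = j x /\ y' = j y /\ pr k (pr x y) ∈ f.
Proof.
  rewrite incl_pr_in. split.
  - intros (k & a & -> & E & H). symmetry in E.
    destruct (incl_pr_inv E) as (x & y & -> & -> & ->). exists k, x, y. auto.
  - intros (k & x & y & -> & -> & -> & H). exists k, (pr x y). rewrite incl_pr. auto.
Qed.

Lemma incl_pr_in' (f x y : V) : pr (j x) (j y) ∈ j f <-> pr x y ∈ f.
Proof. rewrite <- incl_pr. apply incl_in. Qed.

Lemma incl_pr2_in' (f k x y : V) : pr (j k) (pr (j x) (j y)) ∈ j f <-> pr k (pr x y) ∈ f.
Proof. rewrite <- !incl_pr. apply incl_in. Qed.

Lemma incl_function (f X Y : V) :
  is_function (j f) (j X) (j Y) <-> is_function f X Y.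
Proof.
  rewrite (is_functionE HV), (is_functionE HV'). split; intros (H1 & H2 & H3).
  - split; [|split].
    + intros p Hp. apply incl_in in Hp. destruct (H1 _ Hp) as (x' & y' & Hx & Hy & E).
      destruct (incl_pr_inv E) as (x & y & -> & -> & ->).
      apply incl_in in Hx, Hy. eauto.
    + intros x Hx. apply incl_in in Hx. destruct (H2 _ Hx) as [y' Hy].
      apply incl_pr_in in Hy. destruct Hy as (x0 & y & E & -> & Hy).
      apply incl_inj in E. subst x0. eauto.
    + intros x y y' Hy Hy'. apply (incl_inj (e := j)).
      apply (H3 (j x)); apply incl_pr_in'; assumption.
  - split; [|split].
    + intros p Hp. apply incl_elt in Hp. destruct Hp as (p0 & -> & Hp).
      destruct (H1 _ Hp) as (x & y & Hx & Hy & ->). exists (j x), (j y).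
      rewrite !incl_in, incl_pr. auto.
    + intros x Hx. apply incl_elt in Hx. destruct Hx as (x0 & -> & Hx).
      destruct (H2 _ Hx) as [y Hy]. exists (j y). apply incl_pr_in'. exact Hy.
    + intros x y y' Hy Hy'. apply incl_pr_in in Hy, Hy'.
      destruct Hy as (x0 & y0 & -> & -> & Hy). destruct Hy' as (x1 & y1 & E & -> & Hy').
      apply incl_inj in E. subst x1. f_equal. eauto.
Qed.

Lemma incl_label (v : V) (y' : V') : label (j v) y' <-> exists y, y' = j y /\ label v y.
Proof.
  split.
  - intros [u' E]. destruct (incl_pr_inv E) as (u & y & -> & -> & ->).
    exists y. split; [reflexivity|]. exists u. reflexivity.
  - intros (y & -> & u & ->). exists (j u). apply incl_pr.
Qed.

Lemma incl_label' (v y : V) : label (j v) (j y) <-> label v y.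
Proof.
  rewrite incl_label. split.
  - intros (z & E & H). apply incl_inj in E. subst z. exact H.
  - eauto.
Qed.

Lemma incl_in_copy (XA XB y i : V) (x' : V') :
  in_copy (j XA) (j XB) (j y) (j i) x' <-> exists x, x' = j x /\ in_copy XA XB y i x.
Proof.
  unfold in_copy. split.
  - intros [[E H]|[N H]]; apply incl_elt in H; destruct H as (x & -> & H); exists x.
    + apply incl_inj in E. auto.
    + split; [reflexivity|]. right. split; [|exact H]. intros ->. auto.
  - intros (x & -> & [[-> H]|[N H]]); [left|right]; (split; [|apply incl_in; exact H]); auto.
    intros E. apply incl_inj in E. auto.
Qed.

Lemma incl_child (E : V) (v' i' x' w' : V') : child (j E) v' i' x' w' <->
  exists v i x w, v' = j v /\ i' = j i /\ x' = j x /\ w' = j w /\ child E v i x w.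
Proof.
  unfold child. rewrite incl_pr_in. split.
  - intros (a & w & E1 & -> & H). symmetry in E1.
    destruct (incl_pr_inv E1) as (v & b & -> & -> & E2). symmetry in E2.
    destruct (incl_pr_inv E2) as (i & x & -> & -> & ->). exists v, i, x, w. auto.
  - intros (v & i & x & w & -> & -> & -> & -> & H).
    exists (pr v (pr i x)), w. rewrite !incl_pr. auto.
Qed.

Lemma incl_child' (E v i x w : V) : child (j E) (j v) (j i) (j x) (j w) <-> child E v i x w.
Proof. unfold child. rewrite <- !incl_pr. apply incl_in. Qed.

(** Every object about which a clause speaks is a member of a set of [V] or a component of such a
    member. Transitivity brings it back to [V], where the clause holds. *)
Lemma incl_tree (J XA XB p q W rp rq E rk : V) : tree J XA XB p q W rp rq E rk ->
  tree (j J) (j XA) (j XB) (j p) (j q) (j W) (j rp) (j rq) (j E) (j rk).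
Proof.
  intros T. split.
  - apply incl_in, (tree_p T).
  - apply incl_in, (tree_q T).
  - intros K. apply incl_inj in K. exact (tree_pq T K).
  - apply incl_in, (tree_rp T).
  - apply incl_in, (tree_rq T).
  - apply incl_label', (tree_label_p T).
  - apply incl_label', (tree_label_q T).
  - intros w' H. apply incl_elt in H. destruct H as (w & -> & H).
    destruct (tree_label T H) as (y & Hy & K). exists (j y).
    rewrite incl_in, incl_label'. auto.
  - intros v' i' x' w' H. apply incl_child in H.
    destruct H as (v & i & x & w & -> & -> & -> & -> & H).
    destruct (tree_dom T H) as (H1 & H2 & H3 & y & H4 & H5). rewrite !incl_in.
    do 3 (split; [assumption|]). exists (j y). rewrite incl_label', incl_in_copy. eauto.
  - intros v' i' x' w' H. apply incl_child in H.
    destruct H as (v & i & x & w & -> & -> & -> & -> & H).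
    apply incl_label', (tree_label_child T H).
  - intros v' i' x' y' Hv Hi Hy Hx. apply incl_elt in Hv, Hi.
    destruct Hv as (v & -> & Hv). destruct Hi as (i & -> & Hi).
    apply incl_label in Hy. destruct Hy as (y & -> & Hy).
    apply incl_in_copy in Hx. destruct Hx as (x & -> & Hx).
    destruct (tree_child T Hv Hi Hy Hx) as [w Hw]. exists (j w). apply incl_child'. exact Hw.
  - intros v' i' x' w1 w2 H1 H2. apply incl_child in H1, H2.
    destruct H1 as (v & i & x & w & -> & -> & -> & -> & H1).
    destruct H2 as (v0 & i0 & x0 & w0 & E1 & E2 & E3 & -> & H2).
    apply incl_inj in E1, E2, E3. subst. f_equal. exact (tree_fun T H1 H2).
  - intros v1 i1 x1 v2 i2 x2 w' H1 H2. apply incl_child in H1, H2.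
    destruct H1 as (v & i & x & w & -> & -> & -> & -> & H1).
    destruct H2 as (v0 & i0 & x0 & w0 & -> & -> & -> & E1 & H2).
    apply incl_inj in E1. subst w0. destruct (tree_inj T H1 H2) as (-> & -> & ->). auto.
  - intros v' i' x' w' H. apply incl_child in H.
    destruct H as (v & i & x & w & -> & -> & -> & -> & H).
    destruct (tree_root T H) as [H1 H2].
    split; intros K; apply incl_inj in K; auto.
  - intros w' H. apply incl_elt in H. destruct H as (w & -> & H).
    destruct (tree_inv T H) as [->|[->|(v & i & x & Hc)]]; auto.
    right. right. exists (j v), (j i), (j x). apply incl_child'. exact Hc.
  - intros w' H. apply incl_elt in H. destruct H as (w & -> & H).
    destruct (tree_rank T H) as [n Hn]. exists (j n). apply incl_pr_in'. exact Hn.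
  - intros v' i' x' w' m' n' H Hm Hn. apply incl_child in H. apply incl_pr_in in Hm, Hn.
    destruct H as (v & i & x & w & -> & -> & -> & -> & H).
    destruct Hm as (v0 & m & E1 & -> & Hm). destruct Hn as (w0 & n & E2 & -> & Hn).
    apply incl_inj in E1, E2. subst. apply incl_in, (tree_rank_child T H Hm Hn).
Qed.

Lemma incl_tree_rel (GA GB p q E G : V) :
  (forall k w w', pr k (pr w w') ∈ G <-> tree_rel GA GB p q E k w w') ->
  forall k w w', pr k (pr w w') ∈ j G <-> tree_rel (j GA) (j GB) (j p) (j q) (j E) k w w'.
Proof.
  intros HG k' w1' w2'. rewrite incl_pr2_in. split.
  - intros (k & w1 & w2 & -> & -> & -> & H). apply HG in H.
    destruct H as [(i & x & -> & H)|(l & v & i & y & x1 & x2 & -> & H1 & H2 & H3 & H4)].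
    + left. exists (j i), (j x). rewrite incl_pr, incl_child'. auto.
    + right. exists (j l), (j v), (j i), (j y), (j x1), (j x2).
      rewrite incl_pr, !incl_child', incl_label', !incl_pr2_in'.
      do 4 (split; [auto|]). destruct H4 as [[-> H4]|[N H4]]; [auto|]. right.
      split; [|exact H4]. intros K. apply incl_inj in K. auto.
  - intros [(i' & x' & -> & H)|(l' & v' & i' & y' & x1' & x2' & -> & H1 & H2 & H3 & H4)].
    + apply incl_child in H. destruct H as (v & i & x & w & -> & -> & -> & -> & H).
      exists (pr p i), v, w. rewrite incl_pr. do 3 (split; [reflexivity|]).
      apply HG. left. eauto.
    + apply incl_child in H1, H2. destruct H1 as (v & i & x1 & w1 & -> & -> & -> & -> & H1).
      destruct H2 as (v0 & i0 & x2 & w2 & E1 & E2 & -> & -> & H2).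
      apply incl_inj in E1, E2. subst v0 i0. apply incl_label in H3.
      destruct H3 as (y & -> & H3).
      assert (K : exists l, l' = j l /\
        ((i = y /\ pr l (pr x1 x2) ∈ GB) \/ (i <> y /\ pr l (pr x1 x2) ∈ GA))).
      { destruct H4 as [[K H4]|[N H4]]; apply incl_pr2_in in H4;
          destruct H4 as (l & a & b & -> & E1 & E2 & H4);
          apply incl_inj in E1, E2; subst a b; exists l; (split; [reflexivity|]).
        - apply incl_inj in K. auto.
        - right. split; [|exact H4]. intros ->. auto. }
      destruct K as (l & -> & K). exists (pr q l), w1, w2. rewrite incl_pr.
      do 3 (split; [reflexivity|]). apply HG. right. exists l, v, i, y, x1, x2. auto 8.
Qed.

End Extension.

(** * Binary structures as first-order structures *)

(** The function on {a, b} with values [x] and [y], as a set of pairs. With a = 0 and b = 1 it is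
    the 2-tuple that [is_relation_on] expects. *)
Definition tup (M : set_universe) (a b x y : M) : M := upair (pr a x) (pr b y).

Section Tuples.

Context (M : set_universe) (HM : ZFC M) (a b n : M).
Context (Hab : a <> b) (Hn : forall z, z ∈ n <-> z = a \/ z = b).

Lemma tup_in x y i z : pr i z ∈ tup a b x y <-> (i = a /\ z = x) \/ (i = b /\ z = y).
Proof.
  unfold tup. rewrite (upairE HM). split.
  - intros [K|K]; apply (pr_inj HM) in K; auto.
  - intros [[-> ->]|[-> ->]]; auto.
Qed.

Lemma tup_function X x y : x ∈ X -> y ∈ X -> is_function (tup a b x y) n X.
Proof.
  intros Hx Hy. apply (is_functionE HM). split; [|split].
  - intros t Ht. apply (upairE HM) in Ht. destruct Ht as [->| ->].
    + exists a, x. rewrite Hn. auto.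
    + exists b, y. rewrite Hn. auto.
  - intros i Hi. apply Hn in Hi. destruct Hi as [->| ->]; [exists x|exists y];
      apply tup_in; auto.
  - intros i z z' H H'. apply tup_in in H, H'. intuition congruence.
Qed.

Lemma function_tup X s : is_function s n X ->
  exists x y, x ∈ X /\ y ∈ X /\ s = tup a b x y.
Proof.
  intros Hs.
  destruct (is_function_tot HM (x := a) Hs) as [x Hx]; [apply Hn; auto|].
  destruct (is_function_tot HM (x := b) Hs) as [y Hy]; [apply Hn; auto|].
  destruct (is_function_dom HM Hs Hx) as [_ Kx]. destruct (is_function_dom HM Hs Hy) as [_ Ky].
  exists x, y. do 2 (split; [assumption|]). symmetry.
  apply (is_function_eq HM (tup_function Kx Ky) Hs).
  intros i z H. apply tup_in in H. destruct H as [[-> ->]|[-> ->]]; assumption.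
Qed.

Lemma tup_inj x y x' y' : tup a b x y = tup a b x' y' -> x = x' /\ y = y'.
Proof.
  intros E.
  assert (H : pr a x ∈ tup a b x' y') by (rewrite <- E; apply tup_in; auto).
  assert (K : pr b y ∈ tup a b x' y') by (rewrite <- E; apply tup_in; auto).
  apply tup_in in H, K. intuition congruence.
Qed.

End Tuples.

Lemma incl_tup (V V' : set_universe) (HV : ZFC V) (HV' : ZFC V') (j : extension V V')
  (a b x y : V) : j (tup a b x y) = tup (j a) (j b) (j x) (j y).
Proof. unfold tup. rewrite (incl_upair HV HV'), !(incl_pr HV HV'). reflexivity. Qed.

(** The language has a binary relation symbol for each name in [K] and no function symbols. A
    2-tuple is determined by its two values, so preservation of tuples amounts to preservation of
    triples; as [L] and [C] must not depend on [V'], this is asserted for all extensions at once. *)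
Lemma binary_language (V : set_universe) (HV : ZFC V) (W K G : V) :
  (exists x, x ∈ W) ->
  (forall k w w', pr k (pr w w') ∈ G -> k ∈ K /\ w ∈ W /\ w' ∈ W) ->
  exists (L : language V) (C : structure V), is_language L /\ is_structure L C /\ dom C = W /\
    forall (V' : set_universe) (HV' : ZFC V') (j : extension V V') (s : V'),
      is_isomorphism (language_in j L) (structure_in j C) (structure_in j C) s <->
      biniso (j W) (j G) (j W) (j G) s.
Proof.
  intros HW HG.
  destruct (exists_omega HV) as [w Hw]. pose proof Hw as [[(a & Ha & Wa) Hs] _].
  (* Here a = 0, b = 1 and n = 2, so [n] is the common arity and {a, b} the domain of the tuples. *)
  destruct (Hs _ Wa) as (b & Hb & Wb). destruct (Hs _ Wb) as (n & Hn & Wn). clear Hs.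
  assert (Hab : a <> b).
  { intros ->. apply (@mem_irrefl _ HV b). apply Hb. auto. }
  assert (En : forall z, z ∈ n <-> z = a \/ z = b).
  { intros z. rewrite (Hn z), (Hb z). split; [|tauto].
    intros [[H|H]|H]; auto. destruct (Ha _ H). }
  destruct (exists_relation HV (X := K) (Y := w) (P := fun k m => k ∈ K /\ m = n))
    as (ra & Hra & Kra). { dfn. } { intros k m [Hk ->]. auto. }
  destruct (exists_prod HV n W) as [nW HnW].
  destruct (zfc_powerset HV nW) as [S HS]. destruct (zfc_powerset HV S) as [PS HPS].
  set (interp := fun k R => forall t, t ∈ R <->
    exists x y, t = tup a b x y /\ pr k (pr x y) ∈ G).
  assert (tupS : forall x y, x ∈ W -> y ∈ W -> tup a b x y ∈ S).
  { intros x y Hx Hy. apply HS. intros t Ht. apply (upairE HV) in Ht. apply HnW.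
    destruct Ht as [->| ->]; [exists a, x|exists b, y]; rewrite En; auto. }
  destruct (exists_relation HV (X := K) (Y := PS) (P := fun k R => k ∈ K /\ interp k R))
    as (I & HI & KI).
  { unfold interp, tup. dfn. }
  { intros k R [Hk HR]. split; [exact Hk|]. apply HPS. intros t Ht. apply HR in Ht.
    destruct Ht as (x & y & -> & H). apply HG in H. destruct H as (_ & Hx & Hy). auto. }
  assert (TI : forall k, k ∈ K -> exists R, interp k R).
  { intros k Hk. destruct (separation HV
      (P := fun t => exists x y, t = tup a b x y /\ pr k (pr x y) ∈ G) S) as [R HR].
    { unfold tup. dfn. }
    exists R. intros t. rewrite HR. split; [tauto|]. intros H. split; [|exact H].
    destruct H as (x & y & -> & H). apply HG in H. destruct H as (_ & Hx & Hy). auto. }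
  assert (FI : is_function I K PS).
  { apply (is_functionE HV). split; [exact KI|]. split.
    - intros k Hk. destruct (TI k Hk) as [R HR]. exists R. apply HI. auto.
    - intros k R R' H H'. apply HI in H, H'. apply (ext_eq HV). intros t.
      rewrite (proj2 H t), (proj2 H' t). tauto. }
  assert (Fe : forall Y, is_function a a Y).
  { intros Y. apply (is_functionE HV). split; [|split].
    - intros t Ht. destruct (Ha _ Ht).
    - intros t Ht. destruct (Ha _ Ht).
    - intros x y y' H. destruct (Ha _ H). }
  (* The empty set [a] is at once the set of function symbols, their arity function and their
     interpretation. *)
  exists (Language K ra a a), (Structure W I a). split; [|split; [|split; [reflexivity|]]].
  - exists w. simpl. split; [exact Hw|]. split; [|apply Fe].
    apply (is_functionE HV). split; [exact Kra|]. split.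
    + intros k Hk. exists n. apply Hra. auto.
    + intros k m m' H H'. apply Hra in H, H'. intuition congruence.
  - split; [exact HW|]. simpl. split; [exists PS; exact FI|]. split; [|split].
    + intros k m R Hm HR. apply (maps_toE HV) in Hm, HR. apply Hra in Hm. apply HI in HR.
      destruct Hm as [_ ->]. intros t Ht. apply HR in Ht. destruct Ht as (x & y & -> & H).
      apply HG in H. apply (tup_function HV Hab En); tauto.
    + exists a. apply Fe.
    + intros g m F Hm. apply (maps_toE HV) in Hm. destruct (Ha _ Hm).
  - intros V' HV' j s.
    assert (Hab' : j a <> j b) by (intros E; apply incl_inj in E; auto).
    assert (En' : forall z, z ∈ j n <-> z = j a \/ z = j b).
    { intros z. split.
      - intros H. apply incl_elt in H. destruct H as (t & -> & H). apply En in H.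
        destruct H as [->| ->]; auto.
      - intros [->| ->]; apply incl_in, En; auto. }
    assert (rel : forall k R x y, pr k R ∈ I ->
      (tup (j a) (j b) x y ∈ j R <-> pr (j k) (pr x y) ∈ j G)).
    { intros k R x y HR. apply HI in HR. destruct HR as [_ HR]. split; intros H.
      - apply incl_elt in H. destruct H as (t & E & H). apply HR in H.
        destruct H as (x0 & y0 & -> & H). rewrite (incl_tup HV HV') in E.
        apply (tup_inj HV' Hab') in E. destruct E as [-> ->].
        apply (incl_pr2_in' HV HV'). exact H.
      - apply (incl_pr2_in HV HV') in H. destruct H as (k0 & x0 & y0 & E & -> & -> & H).
        apply incl_inj in E. subst k0. rewrite <- (incl_tup HV HV'). apply incl_in, HR. eauto. }
    unfold is_isomorphism, biniso. simpl. split.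
    + intros (B & R & _). split; [exact B|]. intros k' x x' y y' Hx Hx'.
      destruct (is_bijection_dom HV' B Hx) as [Wx Wy].
      destruct (is_bijection_dom HV' B Hx') as [Wx' Wy'].
      assert (key : forall k R0, pr k R0 ∈ I ->
        (pr (j k) (pr x x') ∈ j G <-> pr (j k) (pr y y') ∈ j G)).
      { intros k R0 HR0. rewrite <- !(rel _ _ _ _ HR0).
        pose proof (proj1 (proj1 (HI _ _) HR0)) as Hk.
        apply (R (j k) (j n) (j R0) (j R0)).
        - apply (maps_toE HV'), (incl_pr_in' HV HV'), Hra. auto.
        - apply (maps_toE HV'), (incl_pr_in' HV HV'). exact HR0.
        - apply (maps_toE HV'), (incl_pr_in' HV HV'). exact HR0.
        - apply (tup_function HV' Hab' En'); assumption.
        - split; [apply (tup_function HV' Hab' En'); assumption|].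
          intros i u z Hu Hz. apply (maps_toE HV') in Hu, Hz. apply (maps_toE HV').
          apply (tup_in HV'). apply (tup_in HV') in Hu. destruct B as [B _].
          destruct Hu as [[-> ->]|[-> ->]]; [left|right]; (split; [reflexivity|]).
          + exact (is_function_fun HV' B Hz Hx).
          + exact (is_function_fun HV' B Hz Hx'). }
      (* The name [k'] ranges over all of [V'], but a triple of [j G] comes from [V]; its name is
         then in [K] and has an interpretation, so [key] applies. *)
      split; intros H; apply (incl_pr2_in HV HV') in H as (k & u & u' & -> & E1 & E2 & H);
        pose proof (HG _ _ _ H) as (Hk & _); destruct (TI k Hk) as [R0 HR0];
        (apply (key k R0); [apply HI; auto|]); rewrite E1, E2;
        apply (incl_pr2_in' HV HV'); exact H.
    + intros [B R]. split; [exact B|]. split.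
      * intros k' n' R1 R2 t t' Hn' H1 H2 Ht [Ht' Hi]. apply (maps_toE HV') in Hn', H1, H2.
        apply (incl_pr_in HV HV') in Hn', H1, H2.
        destruct Hn' as (k & m & -> & -> & Hk). apply Hra in Hk. destruct Hk as [Hk ->].
        destruct H1 as (k1 & R1' & E1 & -> & H1). apply incl_inj in E1. subst k1.
        destruct H2 as (k2 & R2' & E2 & -> & H2). apply incl_inj in E2. subst k2.
        rewrite (is_function_fun HV FI H2 H1).
        destruct (function_tup HV' Hab' En' Ht) as (x & x' & Hx & Hx' & ->).
        destruct (function_tup HV' Hab' En' Ht') as (y & y' & Hy & Hy' & ->).
        rewrite !(rel _ _ _ _ H1).
        assert (im : forall i u, pr i u ∈ tup (j a) (j b) x x' -> exists z,
          pr u z ∈ s /\ pr i z ∈ tup (j a) (j b) y y').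
        { intros i u Hu.
          destruct (is_function_dom HV' Ht Hu) as [_ Ku]. destruct B as [B _].
          destruct (is_function_tot HV' B Ku) as [z Hz]. exists z. split; [exact Hz|].
          apply (maps_toE HV'). apply (Hi i u z); apply (maps_toE HV'); assumption. }
        apply R.
        -- destruct (im (j a) x) as (z & Hz & K1); [apply (tup_in HV'); auto|].
           apply (tup_in HV') in K1. destruct K1 as [[_ ->]|[E _]]; [exact Hz|]. destruct (Hab' E).
        -- destruct (im (j b) x') as (z & Hz & K1); [apply (tup_in HV'); auto|].
           apply (tup_in HV') in K1. destruct K1 as [[E _]|[_ ->]]; [|exact Hz].
           destruct (Hab' (eq_sym E)).
      * intros g m F F' t t' x y Hm. apply (maps_toE HV') in Hm.
        apply incl_elt in Hm. destruct Hm as (z & _ & Hz). destruct (Ha _ Hz).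
Qed.

(** * Coding a structure by a binary structure *)

(** The form in which being a structure is transferred: the list is established for the image of a
    structure of [V] in an extension. All clauses but [wf_op_tot] come down to sets of [V]; that one
    quantifies over the tuples of the extension. *)
Record wf_structure (M : set_universe) (ra fa : M) (A : structure M) : Prop := {
  wf_ra : forall r n n', pr r n ∈ ra -> pr r n' ∈ ra -> n = n';
  wf_fa : forall g n n', pr g n ∈ fa -> pr g n' ∈ fa -> n = n';
  wf_rel_dom : forall r R, pr r R ∈ rel_interp A -> exists n, pr r n ∈ ra;
  wf_rel_tot : forall r n, pr r n ∈ ra -> exists R, pr r R ∈ rel_interp A;
  wf_rel_fun : forall r R R', pr r R ∈ rel_interp A -> pr r R' ∈ rel_interp A -> R = R';
  wf_rel : forall r n R s, pr r n ∈ ra -> pr r R ∈ rel_interp A -> s ∈ R ->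
    is_function s n (dom A);
  wf_fun_dom : forall g F, pr g F ∈ fun_interp A -> exists n, pr g n ∈ fa;
  wf_fun_tot : forall g n, pr g n ∈ fa -> exists F, pr g F ∈ fun_interp A;
  wf_fun_fun : forall g F F', pr g F ∈ fun_interp A -> pr g F' ∈ fun_interp A -> F = F';
  wf_op : forall g n F e, pr g n ∈ fa -> pr g F ∈ fun_interp A -> e ∈ F ->
    exists s y, e = pr s y /\ is_function s n (dom A) /\ y ∈ dom A;
  wf_op_tot : forall g n F s, pr g n ∈ fa -> pr g F ∈ fun_interp A ->
    is_function s n (dom A) -> exists y, pr s y ∈ F;
  wf_op_fun : forall g F s y y', pr g F ∈ fun_interp A -> pr s y ∈ F -> pr s y' ∈ F -> y = y' }.

(* A fact of A is a pair (c, e): c = (p, r) and e is a tuple of the relation r,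
   or c = (q, g) and e is a pair (arguments, value) of the operation g. *)
Definition fact (M : set_universe) (p q : M) (A : structure M) (c e : M) : Prop :=
  (exists r R, c = pr p r /\ pr r R ∈ rel_interp A /\ e ∈ R) \/
  (exists g F, c = pr q g /\ pr g F ∈ fun_interp A /\ e ∈ F).

(* "x is the component m of the fact (c, e)": m = (p, i) stands for the i-th
   argument and m = (q, q) for the value. *)
Definition comp (M : set_universe) (p q c e m x : M) : Prop :=
  (exists r i, c = pr p r /\ m = pr p i /\ pr i x ∈ e) \/
  (exists g s y, c = pr q g /\ e = pr s y /\
    ((exists i, m = pr p i /\ pr i x ∈ s) \/ (m = pr q q /\ x = y))).

(** Each fact becomes an element of its own next to the points (p, x). Symbols of any arity are thus
    reduced to binary relations between facts and points. *)
Definition code_dom (M : set_universe) (p q : M) (A : structure M) (z : M) : Prop :=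
  (exists x, x ∈ dom A /\ z = pr p x) \/ (exists c e, z = pr q (pr c e) /\ fact p q A c e).

(** A loop named (p, c) acts as a unary predicate marking the facts of the symbol [c]; the relation
    named (q, m) leads from a fact to its component [m]. *)
Definition code_rel (M : set_universe) (p q : M) (A : structure M) (k z z' : M) : Prop :=
  (exists c e, k = pr p c /\ z = pr q (pr c e) /\ z' = z /\ fact p q A c e) \/
  (exists m c e x, k = pr q m /\ z = pr q (pr c e) /\ z' = pr p x /\ x ∈ dom A /\
    fact p q A c e /\ comp p q c e m x).

Definition is_code (M : set_universe) (p q : M) (A : structure M) (X G : M) : Prop :=
  (forall z, z ∈ X <-> code_dom p q A z) /\
  (forall k z z', pr k (pr z z') ∈ G <-> code_rel p q A k z z').

(** * Existence of codes *)

Section Existence.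

Context (M : set_universe) (HM : ZFC M).

Lemma exists_field (S : M) : exists F, forall a b, pr a b ∈ S -> a ∈ F /\ b ∈ F.
Proof.
  destruct (zfc_union HM S) as [U1 H1]. destruct (zfc_union HM U1) as [U2 H2].
  exists U2. intros a b H.
  assert (K : upair a b ∈ U1).
  { apply H1. exists (pr a b). split; [exact H|]. apply (upairE HM). auto. }
  split; apply H2; exists (upair a b); (split; [exact K|]); apply (upairE HM); auto.
Qed.

Lemma exists_ternary (K X : M) (P : M -> M -> M -> Prop) :
  Dfn (fun v => P (v 0) (v 1) (v 2)) ->
  (forall k x y, P k x y -> k ∈ K /\ x ∈ X /\ y ∈ X) ->
  exists G, forall k x y, pr k (pr x y) ∈ G <-> P k x y.
Proof.
  intros D H. destruct (exists_prod HM X X) as [XX HXX].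
  destruct (exists_relation HM (X := K) (Y := XX)
    (P := fun k a => exists x y, a = pr x y /\ P k x y)) as (G & HG & _).
  { dfn. exact (Dfn_ren (fun n => match n with O => 2 | 1 => 1 | _ => 0 end) D). }
  { intros k a (x & y & -> & Hp). destruct (H _ _ _ Hp) as (H1 & H2 & H3).
    split; [exact H1|]. apply (prod_pr HM _ _ HXX). auto. }
  exists G. intros k x y. rewrite HG. split.
  - intros (x' & y' & E & Hp). apply (pr_inj HM) in E. destruct E as [-> ->]. exact Hp.
  - eauto.
Qed.

(** The unions and products only serve to bound the elements and the names that occur, so that
    separation applies. *)
Lemma exists_code (p q : M) (A : structure M) : exists X G, is_code p q A X G.
Proof.
  destruct (exists_field (rel_interp A)) as [F1 H1].
  destruct (exists_field (fun_interp A)) as [F2 H2].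
  destruct (exists_union2 HM F1 F2) as [F HF].
  destruct (zfc_union HM F) as [E HE].
  destruct (exists_prod HM (upair p q) F) as [C HC].
  destruct (exists_prod HM C E) as [CE HCE].
  destruct (exists_union2 HM (dom A) CE) as [Y HY].
  destruct (exists_prod HM (upair p q) Y) as [Z HZ].
  assert (Hfact : forall c e, fact p q A c e -> c ∈ C /\ e ∈ E).
  { intros c e [(r & R & -> & Hr & He)|(r & R & -> & Hr & He)];
      [apply H1 in Hr|apply H2 in Hr]; destruct Hr as [Hr HR];
      (split; [apply (prod_pr HM _ _ HC); rewrite (upairE HM), HF; auto|]);
      apply HE; exists R; rewrite HF; auto. }
  destruct (separation HM (P := code_dom p q A) Z) as [X HX].
  { unfold code_dom, fact. dfn. }
  assert (HX' : forall z, z ∈ X <-> code_dom p q A z).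
  { intros z. rewrite HX. split; [tauto|]. intros H. split; [|exact H].
    destruct H as [(x & Hx & ->)|(c & e & -> & H)]; apply (prod_pr HM _ _ HZ);
      rewrite (upairE HM), HY; split; auto.
    right. apply (prod_pr HM _ _ HCE). apply Hfact. exact H. }
  (* Positions of arguments are bounded in two ways: a fact of a relation is itself a tuple, whose
     pairs lie in the union of [E]; in a fact of an operation the tuple sits one pair deeper, in the
     field [I2] of [E]. *)
  destruct (zfc_union HM E) as [UE HUE].
  destruct (exists_field UE) as [I1 K1]. destruct (exists_field E) as [I2 K2].
  destruct (zfc_union HM I2) as [UI HUI]. destruct (exists_field UI) as [I3 K3].
  destruct (exists_union2 HM I1 I3) as [I4 K4].
  destruct (exists_union2 HM I4 (upair q q)) as [I HI].
  destruct (exists_prod HM (upair p q) I) as [N HN].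
  destruct (exists_union2 HM C N) as [CN HCN].
  destruct (exists_prod HM (upair p q) CN) as [K HK].
  assert (Hcomp : forall c e m x, e ∈ E -> comp p q c e m x -> m ∈ N).
  { intros c e m x He [(r & i & _ & -> & H)|(g & s & y & _ & -> & [(i & -> & H)|[-> ->]])];
      apply (prod_pr HM _ _ HN); rewrite (upairE HM), HI, K4.
    - split; [auto|]. left. left. apply (K1 i x). apply HUE. eauto.
    - split; [auto|]. left. right. apply (K3 i x). apply HUI. exists s.
      split; [apply (K2 s y He)|exact H].
    - rewrite (upairE HM). auto. }
  destruct (@exists_ternary K X (code_rel p q A)) as [G HG].
  { unfold code_rel, fact, comp. dfn. }
  { intros k z z' [(c & e & -> & -> & -> & H)|(m & c & e & x & -> & -> & -> & Hx & H & H')];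
      rewrite !HX'; unfold code_dom.
    - destruct (Hfact _ _ H) as [Hc He]. split; [|split; right; eauto].
      apply (prod_pr HM _ _ HK). rewrite (upairE HM), HCN. auto.
    - destruct (Hfact _ _ H) as [Hc He]. split; [|split; [right|left]; eauto].
      apply (prod_pr HM _ _ HK). rewrite (upairE HM), HCN. eauto. }
  exists X, G. split; assumption.
Qed.

End Existence.

(** * Isomorphisms of structures and of their codes *)

Section Code.

Context (M : set_universe) (HM : ZFC M) (p q : M) (Hpq : p <> q) (ra fa : M).

Lemma pr_pq x y : pr p x <> pr q y.
Proof. intros E. apply (pr_inj HM) in E. tauto. Qed.

Lemma comp_rel r e i x : comp p q (pr p r) e (pr p i) x <-> pr i x ∈ e.
Proof.
  split.
  - intros [(r' & i' & _ & E & H)|(g & s & y & E & _)].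
    + apply (pr_inj HM) in E. destruct E as [_ ->]. exact H.
    + destruct (pr_pq E).
  - intros H. left. eauto.
Qed.

Lemma comp_arg g s y i x : comp p q (pr q g) (pr s y) (pr p i) x <-> pr i x ∈ s.
Proof.
  split.
  - intros [(r & i' & E & _)|(g' & s' & y' & _ & E & [(i' & E' & H)|[E' _]])].
    + destruct (pr_pq (eq_sym E)).
    + apply (pr_inj HM) in E, E'. destruct E as [-> _]. destruct E' as [_ ->]. exact H.
    + destruct (pr_pq E').
  - intros H. right. exists g, s, y. do 2 (split; [reflexivity|]). left. eauto.
Qed.

Lemma comp_value g s y x : comp p q (pr q g) (pr s y) (pr q q) x <-> x = y.
Proof.
  split.
  - intros [(r & i' & E & _)|(g' & s' & y' & _ & E & [(i' & E' & H)|[_ ->]])].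
    + destruct (pr_pq (eq_sym E)).
    + destruct (pr_pq (eq_sym E')).
    + apply (pr_inj HM) in E. destruct E as [_ ->]. reflexivity.
  - intros ->. right. exists g, s, y. auto.
Qed.

Lemma comp_dom A c e m x : wf_structure ra fa A -> fact p q A c e -> comp p q c e m x ->
  x ∈ dom A.
Proof.
  intros WA [(r & R & -> & Hr & He)|(g & F & -> & Hg & He)].
  - destruct (wf_rel_dom WA Hr) as [n Hn]. pose proof (wf_rel WA Hn Hr He) as Hs.
    intros [(r' & i' & _ & E & H)|(g & s & y & E & _)].
    + apply (is_function_dom HM Hs H).
    + destruct (pr_pq E).
  - destruct (wf_fun_dom WA Hg) as [n Hn].
    destruct (wf_op WA Hn Hg He) as (s & y & -> & Hs & Hy).
    intros [(r & i' & E & _)|(g' & s' & y' & _ & E & [(i' & E' & H)|[_ ->]])].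
    + destruct (pr_pq (eq_sym E)).
    + apply (pr_inj HM) in E. destruct E as [-> _]. apply (is_function_dom HM Hs H).
    + apply (pr_inj HM) in E. destruct E as [_ ->]. exact Hy.
Qed.

Lemma fact_rel A r R e : wf_structure ra fa A -> pr r R ∈ rel_interp A ->
  (fact p q A (pr p r) e <-> e ∈ R).
Proof.
  intros WA Hr. split.
  - intros [(r' & R' & E & Hr' & He)|(g & F & E & _)]; [|destruct (pr_pq E)].
    apply (pr_inj HM) in E. destruct E as [_ <-].
    rewrite (wf_rel_fun WA Hr Hr'). exact He.
  - intros He. left. eauto.
Qed.

Lemma fact_fun A g F e : wf_structure ra fa A -> pr g F ∈ fun_interp A ->
  (fact p q A (pr q g) e <-> e ∈ F).
Proof.
  intros WA Hg. split.
  - intros [(r & R & E & _)|(g' & F' & E & Hg' & He)]; [destruct (pr_pq (eq_sym E))|].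
    apply (pr_inj HM) in E. destruct E as [_ <-].
    rewrite (wf_fun_fun WA Hg Hg'). exact He.
  - intros He. right. eauto.
Qed.

(** The symbol fixes the arity, so the two tuples are functions on the same domain and inclusion of
    their components makes them equal; an operation adds its value as a further component. *)
Lemma fact_eq A c e e' : wf_structure ra fa A -> fact p q A c e -> fact p q A c e' ->
  (forall m x, comp p q c e m x -> comp p q c e' m x) -> e = e'.
Proof.
  intros WA [(r & R & -> & Hr & He)|(g & F & -> & Hg & He)] He' H.
  - apply (fact_rel _ WA Hr) in He'. destruct (wf_rel_dom WA Hr) as [n Hn].
    apply (is_function_eq HM (wf_rel WA Hn Hr He) (wf_rel WA Hn Hr He')).
    intros i x Hx. apply (comp_rel r), H, comp_rel. exact Hx.
  - apply (fact_fun _ WA Hg) in He'. destruct (wf_fun_dom WA Hg) as [n Hn].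
    destruct (wf_op WA Hn Hg He) as (s & y & -> & Hs & _).
    destruct (wf_op WA Hn Hg He') as (s' & y' & -> & Hs' & _).
    f_equal.
    + apply (is_function_eq HM Hs Hs'). intros i x Hx.
      apply (comp_arg g s' y'), H, comp_arg. exact Hx.
    + apply (comp_value g s'), H, comp_value. reflexivity.
Qed.

Lemma code_label A X G c z : is_code p q A X G ->
  (pr (pr p c) (pr z z) ∈ G <-> exists e, z = pr q (pr c e) /\ fact p q A c e).
Proof.
  intros [_ HG]. rewrite HG. split.
  - intros [(c' & e & E & -> & _ & H)|(m & c' & e & x & E & _)]; [|destruct (pr_pq E)].
    apply (pr_inj HM) in E. destruct E as [_ <-]. eauto.
  - intros (e & -> & H). left. eauto 6.
Qed.

Lemma code_comp A X G c e m x : is_code p q A X G -> fact p q A c e -> x ∈ dom A ->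
  (pr (pr q m) (pr (pr q (pr c e)) (pr p x)) ∈ G <-> comp p q c e m x).
Proof.
  intros [_ HG] Hf Hx. rewrite HG. split.
  - intros [(c' & e' & E & _)|(m' & c' & e' & x' & E1 & E2 & E3 & _ & _ & H)];
      [destruct (pr_pq (eq_sym E))|].
    apply (pr_inj HM) in E1, E2, E3. destruct E1 as [_ <-]. destruct E2 as [_ E2].
    destruct E3 as [_ <-]. apply (pr_inj HM) in E2. destruct E2 as [<- <-]. exact H.
  - intros H. right. exists m, c, e, x. auto 8.
Qed.

Lemma point_in A X G x : is_code p q A X G -> (pr p x ∈ X <-> x ∈ dom A).
Proof.
  intros [HX _]. rewrite HX. split.
  - intros [(x' & Hx & E)|(c & e & E & _)]; [|destruct (pr_pq E)].
    apply (pr_inj HM) in E. destruct E as [_ ->]. exact Hx.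
  - intros H. left. eauto.
Qed.

(** The loop of a fact preserves its symbol, and the relations named (q, m) preserve its
    components. *)
Lemma fact_image A B X G X' G' h c e : is_code p q A X G -> is_code p q B X' G' ->
  biniso X G X' G' h -> fact p q A c e -> exists e', fact p q B c e' /\
    forall m x x', pr (pr p x) (pr p x') ∈ h -> (comp p q c e m x <-> comp p q c e' m x').
Proof.
  intros CA CB [Hb R] He.
  assert (Hz : pr q (pr c e) ∈ X) by (apply (proj1 CA); right; eauto).
  destruct (is_function_tot HM (proj1 Hb) Hz) as [z' Hz'].
  destruct (proj1 (code_label c z' CB)) as (e' & -> & He').
  { apply (R _ _ _ _ _ Hz' Hz'), (code_label _ _ CA). eauto. }
  exists e'. split; [exact He'|]. intros m x x' Hx.
  destruct (is_bijection_dom HM Hb Hx) as [Dx Dx'].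
  apply (point_in _ CA) in Dx. apply (point_in _ CB) in Dx'.
  rewrite <- (code_comp m CA He Dx), <- (code_comp m CB He' Dx').
  apply R; assumption.
Qed.

(** Every fact carries a loop named (p, c) for its symbol and a point carries none, so points go to
    points. *)
Lemma point_image A B X G X' G' h x : is_code p q A X G -> is_code p q B X' G' ->
  biniso X G X' G' h -> x ∈ dom A -> exists x', pr (pr p x) (pr p x') ∈ h.
Proof.
  intros CA CB [Hb R] Hx. apply (point_in _ CA) in Hx.
  destruct (is_function_tot HM (proj1 Hb) Hx) as [z' Hz'].
  destruct (is_bijection_dom HM Hb Hz') as [_ Dz'].
  apply (proj1 CB) in Dz'. destruct Dz' as [(x' & _ & ->)|(c & e & -> & He)]; [eauto|].
  destruct (proj1 (code_label c (pr p x) CA)) as (e' & E & _).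
  - apply (R _ _ _ _ _ Hz' Hz'), (code_label _ _ CB). eauto.
  - destruct (pr_pq E).
Qed.

(** The restriction of [h] to points is the isomorphism. The image of a fact has the same symbol and
    corresponding components, which gives preservation of relations and operations; the inverse of
    [h] gives the converse for relations. *)
Lemma iso_of_code rs fs A B X G X' G' h :
  wf_structure ra fa A -> wf_structure ra fa B ->
  is_code p q A X G -> is_code p q B X' G' -> biniso X G X' G' h ->
  isomorphic (Language rs ra fs fa) A B.
Proof.
  intros WA WB CA CB Hh.
  destruct (biniso_inv HM Hh) as (h' & Hh' & Eh').
  destruct (exists_relation HM (X := dom A) (Y := dom B)
    (P := fun x x' => pr (pr p x) (pr p x') ∈ h)) as (f & Hf & Kf).
  { dfn. }
  { intros x x' H. destruct (is_bijection_dom HM (proj1 Hh) H) as [H1 H2].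
    apply (point_in _ CA) in H1. apply (point_in _ CB) in H2. auto. }
  assert (Bf : is_bijection f (dom A) (dom B)).
  { pose proof (proj1 Hh) as Bh. apply (is_bijectionE HM) in Bh.
    destruct Bh as (_ & _ & B3 & B4 & _).
    apply (is_bijectionE HM). split; [exact Kf|]. split; [|split; [|split]].
    - intros x Hx. destruct (point_image CA CB Hh Hx) as [x' Hx']. exists x'. apply Hf. exact Hx'.
    - intros x y y' H H'. apply Hf in H, H'. pose proof (B3 _ _ _ H H') as E.
      apply (pr_inj HM) in E. tauto.
    - intros x x' y H H'. apply Hf in H, H'. pose proof (B4 _ _ _ H H') as E.
      apply (pr_inj HM) in E. tauto.
    - intros y Hy. destruct (point_image CB CA Hh' Hy) as [x Hx]. exists x. apply Hf, Eh'.
      exact Hx. }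
  assert (tuples : forall n s t s', is_function s n (dom A) -> is_tuple_image f n (dom B) s t ->
    is_function s' n (dom B) ->
    (forall i x x', pr x x' ∈ f -> pr i x ∈ s -> pr i x' ∈ s') -> s' = t).
  { intros n s t s' Hs [Ht Hi] Hs' H. symmetry. apply (is_function_eq HM Ht Hs').
    intros i y Hy. destruct (is_function_dom HM Ht Hy) as [Di _].
    destruct (is_function_tot HM Hs Di) as [x Hx].
    destruct (is_function_dom HM Hs Hx) as [_ Dx].
    destruct (is_function_tot HM (proj1 Bf) Dx) as [x' Hx'].
    assert (K : pr i x' ∈ t).
    { apply (maps_toE HM). apply (Hi i x x'); apply (maps_toE HM); assumption. }
    rewrite (is_function_fun HM Ht Hy K). eauto. }
  exists f. split; [exact Bf|]. simpl. split.
  - intros r n R R' s t Hn HR HR' Hs Ht. apply (maps_toE HM) in Hn, HR, HR'. split; intros H.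
    + destruct (@fact_image A B X G X' G' h (pr p r) s) as (s' & Hs' & Hc); try assumption.
      { apply (fact_rel _ WA HR). exact H. }
      apply (fact_rel _ WB HR') in Hs'.
      rewrite <- (tuples n s t s'); try assumption.
      { exact (wf_rel WB Hn HR' Hs'). }
      intros i x x' Hx Hi. apply (comp_rel r), (Hc (pr p i) x x'); [apply Hf; exact Hx|].
      apply comp_rel. exact Hi.
    + destruct (@fact_image B A X' G' X G h' (pr p r) t) as (s' & Hs' & Hc); try assumption.
      { apply (fact_rel _ WB HR'). exact H. }
      apply (fact_rel _ WA HR) in Hs'.
      rewrite (is_function_eq HM (f := s) (g := s') Hs (wf_rel WA Hn HR Hs')); [exact Hs'|].
      intros i x Hx. destruct (is_function_dom HM Hs Hx) as [_ Dx].
      destruct (is_function_tot HM (proj1 Bf) Dx) as [x' Hx'].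
      apply (comp_rel r), (Hc (pr p i) x' x); [apply Eh', Hf; exact Hx'|].
      apply comp_rel, (maps_toE HM). apply (proj2 Ht i x x'); apply (maps_toE HM); assumption.
  - intros g n F F' s t x y Hn HF HF' Hs Ht Hx Hy.
    apply (maps_toE HM) in Hn, HF, HF', Hx, Hy. apply (maps_toE HM).
    destruct (@fact_image A B X G X' G' h (pr q g) (pr s x)) as (e' & He' & Hc); try assumption.
    { apply (fact_fun _ WA HF). exact Hx. }
    apply (fact_fun _ WB HF') in He'.
    destruct (wf_op WB Hn HF' He') as (s' & y' & -> & Hs' & _).
    rewrite <- (tuples n s t s'); try assumption.
    + assert (E : y = y'); [|rewrite E; exact He'].
      apply (comp_value g s'), (Hc (pr q q) x y); [apply Hf; exact Hy|].
      apply comp_value. reflexivity.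
    + intros i a a' Ha Hi. apply (comp_arg g s' y'), (Hc (pr p i) a a'); [apply Hf; exact Ha|].
      apply comp_arg. exact Hi.
Qed.

Lemma exists_compose (s n X f Y : M) : is_function s n X -> is_function f X Y ->
  exists t, is_function t n Y /\
    forall i y, pr i y ∈ t <-> exists x, pr i x ∈ s /\ pr x y ∈ f.
Proof.
  intros Hs Hf.
  destruct (exists_relation HM (X := n) (Y := Y)
    (P := fun i y => exists x, pr i x ∈ s /\ pr x y ∈ f)) as (t & Ht & Kt).
  { dfn. }
  { intros i y (x & Hi & Hx). split.
    - apply (is_function_dom HM Hs Hi).
    - apply (is_function_dom HM Hf Hx). }
  exists t. split; [|exact Ht]. apply (is_functionE HM). split; [exact Kt|]. split.
  - intros i Hi. destruct (is_function_tot HM Hs Hi) as [x Hx].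
    destruct (is_function_dom HM Hs Hx) as [_ Dx].
    destruct (is_function_tot HM Hf Dx) as [y Hy]. exists y. apply Ht. eauto.
  - intros i y y' H H'. apply Ht in H, H'. destruct H as (x & H1 & H2).
    destruct H' as (x' & H1' & H2'). rewrite (is_function_fun HM Hs H1' H1) in H2'.
    exact (is_function_fun HM Hf H2 H2').
Qed.

(** The map [f] is extended to facts: [e] corresponds to [e'] when they belong to the same symbol
    and [sim] matches their components. Then [forth] and [back] give totality and surjectivity,
    while [fact_eq] gives uniqueness in both directions. *)
Lemma code_of_iso rs fs A B X G X' G' :
  wf_structure ra fa A -> wf_structure ra fa B ->
  is_code p q A X G -> is_code p q B X' G' ->
  isomorphic (Language rs ra fs fa) A B -> exists h, biniso X G X' G' h.
Proof.
  intros WA WB CA CB (f & Bf & Rf & Ff). simpl in Rf, Ff.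
  pose proof Bf as Bf'. apply (is_bijectionE HM) in Bf'.
  destruct Bf' as (_ & F2 & F3 & F4 & F5).
  set (sim := fun c e e' => forall m x x', pr x x' ∈ f -> (comp p q c e m x <-> comp p q c e' m x')).
  assert (inv : exists g, is_function g (dom B) (dom A) /\ forall x y, pr y x ∈ g <-> pr x y ∈ f).
  { destruct (exists_relation HM (X := dom B) (Y := dom A) (P := fun y x => pr x y ∈ f))
      as (g & Hg & Kg).
    { dfn. }
    { intros y x H. destruct (is_bijection_dom HM Bf H). auto. }
    exists g. split; [|intros x y; apply Hg]. apply (is_functionE HM).
    split; [exact Kg|]. split.
    - intros y Hy. destruct (F5 y Hy) as [x Hx]. exists x. apply Hg. exact Hx.
    - intros y x x' H H'. apply Hg in H, H'. eauto. }
  destruct inv as (g & Hg & Eg).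
  assert (sim_tuple : forall n s t, is_function s n (dom A) -> is_function t n (dom B) ->
    (forall i x x', pr x x' ∈ f -> (pr i x ∈ s <-> pr i x' ∈ t)) -> is_tuple_image f n (dom B) s t).
  { intros n s t Hs Ht H. split; [exact Ht|]. intros i x y Hx Hy.
    apply (maps_toE HM) in Hx, Hy. apply (maps_toE HM). apply (H i x y); assumption. }
  assert (image : forall n s, is_function s n (dom A) -> exists t, is_function t n (dom B) /\
    forall i x x', pr x x' ∈ f -> (pr i x ∈ s <-> pr i x' ∈ t)).
  { intros n s Hs. destruct (exists_compose Hs (proj1 Bf)) as (t & Ht & Et).
    exists t. split; [exact Ht|]. intros i x x' Hx. rewrite Et. split; [eauto|].
    intros (y & Hy & Ky). rewrite (F4 _ _ _ Hx Ky). exact Hy. }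
  assert (preimage : forall n t, is_function t n (dom B) -> exists s, is_function s n (dom A) /\
    forall i x x', pr x x' ∈ f -> (pr i x ∈ s <-> pr i x' ∈ t)).
  { intros n t Ht. destruct (exists_compose Ht Hg) as (s & Hs & Es).
    exists s. split; [exact Hs|]. intros i x x' Hx. rewrite Es. split.
    - intros (y & Hy & Ky). apply Eg in Ky. rewrite (F3 _ _ _ Hx Ky). exact Hy.
    - intros H. exists x'. rewrite Eg. auto. }
  assert (sim_rel : forall r s t, (forall i x x', pr x x' ∈ f -> (pr i x ∈ s <-> pr i x' ∈ t)) ->
    sim (pr p r) s t).
  { intros r s t H m x x' Hx. split.
    - intros [(r' & i & _ & -> & K)|(g0 & s0 & y & E & _)]; [|destruct (pr_pq E)].
      apply comp_rel. apply (H i x x' Hx). exact K.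
    - intros [(r' & i & _ & -> & K)|(g0 & s0 & y & E & _)]; [|destruct (pr_pq E)].
      apply comp_rel. apply (H i x x' Hx). exact K. }
  assert (sim_fun : forall k s t y y', (forall i x x', pr x x' ∈ f -> (pr i x ∈ s <-> pr i x' ∈ t)) ->
    pr y y' ∈ f -> sim (pr q k) (pr s y) (pr t y')).
  { intros k s t y y' H Hy m x x' Hx. split.
    - intros [(r & i & E & _)|(k0 & s0 & y0 & _ & E & [(i & -> & K)|[-> ->]])];
        [destruct (pr_pq (eq_sym E))| |]; apply (pr_inj HM) in E; destruct E as [<- <-].
      + apply comp_arg. apply (H i x x' Hx). exact K.
      + apply comp_value. eauto.
    - intros [(r & i & E & _)|(k0 & s0 & y0 & _ & E & [(i & -> & K)|[-> ->]])];
        [destruct (pr_pq (eq_sym E))| |]; apply (pr_inj HM) in E; destruct E as [<- <-].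
      + apply comp_arg. apply (H i x x' Hx). exact K.
      + apply comp_value. eauto. }
  assert (forth : forall c e, fact p q A c e -> exists e', fact p q B c e' /\ sim c e e').
  { intros c e [(r & R & -> & Hr & He)|(k & F & -> & Hk & He)].
    - destruct (wf_rel_dom WA Hr) as [n Hn]. destruct (wf_rel_tot WB Hn) as [R' Hr'].
      pose proof (wf_rel WA Hn Hr He) as Hs. destruct (image n e Hs) as (t & Ht & Et).
      exists t. split; [|apply sim_rel; exact Et]. apply (fact_rel _ WB Hr').
      apply (Rf r n R R' e t); try (apply (maps_toE HM); assumption); auto.
    - destruct (wf_fun_dom WA Hk) as [n Hn]. destruct (wf_fun_tot WB Hn) as [F' Hk'].
      destruct (wf_op WA Hn Hk He) as (s & y & -> & Hs & Hy).
      destruct (image n s Hs) as (t & Ht & Et). destruct (F2 y Hy) as [y' Hy'].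
      exists (pr t y'). split; [|apply sim_fun; assumption]. apply (fact_fun _ WB Hk').
      apply (maps_toE HM).
      apply (Ff k n F F' s t y y'); try (apply (maps_toE HM); assumption); auto. }
  assert (back : forall c e', fact p q B c e' -> exists e, fact p q A c e /\ sim c e e').
  { intros c e [(r & R' & -> & Hr & He)|(k & F' & -> & Hk & He)].
    - destruct (wf_rel_dom WB Hr) as [n Hn]. destruct (wf_rel_tot WA Hn) as [R Hr'].
      pose proof (wf_rel WB Hn Hr He) as Ht. destruct (preimage n e Ht) as (s & Hs & Es).
      exists s. split; [|apply sim_rel; exact Es]. apply (fact_rel _ WA Hr').
      apply (Rf r n R R' s e); try (apply (maps_toE HM); assumption); auto.
    - destruct (wf_fun_dom WB Hk) as [n Hn]. destruct (wf_fun_tot WA Hn) as [F Hk'].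
      destruct (wf_op WB Hn Hk He) as (t & y & -> & Ht & Hy).
      destruct (preimage n t Ht) as (s & Hs & Es).
      (* For operations an isomorphism is only required to preserve values forwards. So the
         operation of [A] is evaluated at the preimage [s], and single-valuedness of [F'] at [t]
         identifies the image of the result with [y]. *)
      destruct (wf_op_tot WA Hn Hk' Hs) as [x Hx].
      assert (Dx : x ∈ dom A).
      { destruct (wf_op WA Hn Hk' Hx) as (s0 & x0 & E & _ & H). apply (pr_inj HM) in E.
        destruct E as [_ ->]. exact H. }
      destruct (F2 x Dx) as [y' Hy'].
      assert (K : pr t y' ∈ F').
      { apply (maps_toE HM).
        apply (Ff k n F F' s t x y'); try (apply (maps_toE HM); assumption); auto. }
      rewrite (wf_op_fun WB Hk He K). exists (pr s x).
      split; [apply (fact_fun _ WA Hk'); exact Hx|]. apply sim_fun; assumption. }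
  destruct (exists_relation HM (X := X) (Y := X') (P := fun z z' =>
    (exists x x', z = pr p x /\ z' = pr p x' /\ pr x x' ∈ f) \/
    (exists c e e', z = pr q (pr c e) /\ z' = pr q (pr c e') /\
      fact p q A c e /\ fact p q B c e' /\ sim c e e'))) as (h & Hh & Kh).
  { unfold sim, fact, comp. dfn. }
  { intros z z' [(x & x' & -> & -> & H)|(c & e & e' & -> & -> & H & H' & _)].
    - destruct (is_bijection_dom HM Bf H). rewrite (point_in _ CA), (point_in _ CB). auto.
    - split; [apply (proj1 CA)|apply (proj1 CB)]; right; eauto. }
  exists h. split.
  - apply (is_bijectionE HM). split; [exact Kh|]. split; [|split; [|split]].
    + intros z Hz. apply (proj1 CA) in Hz. destruct Hz as [(x & Hx & ->)|(c & e & -> & He)].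
      * destruct (F2 x Hx) as [y Hy]. exists (pr p y). apply Hh. left. eauto.
      * destruct (forth c e He) as (e' & He' & S). exists (pr q (pr c e')). apply Hh. right.
        exists c, e, e'. auto.
    + intros z z1 z2 H1 H2. apply Hh in H1, H2.
      destruct H1 as [(x & x' & -> & -> & H1)|(c & e & e' & -> & -> & He & He' & S)];
        destruct H2 as [(y & y' & E & -> & H2)|(d & u & u' & E & -> & Hu & Hu' & S')].
      * apply (pr_inj HM) in E. destruct E as [_ <-]. f_equal. eauto.
      * destruct (pr_pq E).
      * destruct (pr_pq (eq_sym E)).
      * apply (pr_inj HM) in E. destruct E as [_ E]. apply (pr_inj HM) in E.
        destruct E as [<- <-]. do 2 f_equal. apply (fact_eq WB He' Hu').
        intros m x' Hm. destruct (F5 x' (comp_dom WB He' Hm)) as [x Hx].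
        apply (S' m x x' Hx), (S m x x' Hx). exact Hm.
    + intros z1 z2 z H1 H2. apply Hh in H1, H2.
      destruct H1 as [(x & x' & -> & -> & H1)|(c & e & e' & -> & -> & He & He' & S)];
        destruct H2 as [(y & y' & -> & E & H2)|(d & u & u' & -> & E & Hu & Hu' & S')].
      * apply (pr_inj HM) in E. destruct E as [_ <-]. f_equal. eauto.
      * destruct (pr_pq E).
      * destruct (pr_pq (eq_sym E)).
      * apply (pr_inj HM) in E. destruct E as [_ E]. apply (pr_inj HM) in E.
        destruct E as [<- <-]. do 2 f_equal. apply (fact_eq WA He Hu).
        intros m x Hm. destruct (F2 x (comp_dom WA He Hm)) as [x' Hx].
        apply (S' m x x' Hx), (S m x x' Hx). exact Hm.
    + intros z Hz. apply (proj1 CB) in Hz. destruct Hz as [(x & Hx & ->)|(c & e & -> & He)].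
      * destruct (F5 x Hx) as [y Hy]. exists (pr p y). apply Hh. left. eauto.
      * destruct (back c e He) as (e' & He' & S). exists (pr q (pr c e')). apply Hh. right.
        exists c, e', e. auto.
  - intros k z1 z2 z1' z2' H1 H2. apply Hh in H1, H2.
    rewrite (proj2 CA), (proj2 CB). unfold code_rel.
    destruct H1 as [(x1 & x1' & -> & -> & H1)|(c & e & e' & -> & -> & He & He' & S)].
    (* Every relation of a code starts at a fact, so a point in the first place makes both sides
       false. *)
    { split; [intros [(d & u & _ & E & _)|(m & d & u & x & _ & E & _)]
      |intros [(d & u & _ & E & _)|(m & d & u & x & _ & E & _)]]; destruct (pr_pq E). }
    assert (split2 : forall d u, pr q (pr c e) = pr q (pr d u) -> c = d /\ e = u).
    { intros d u E. apply (pr_inj HM) in E. destruct E as [_ E]. apply (pr_inj HM) in E. exact E. }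
    assert (split2' : forall d u, pr q (pr c e') = pr q (pr d u) -> c = d /\ e' = u).
    { intros d u E. apply (pr_inj HM) in E. destruct E as [_ E]. apply (pr_inj HM) in E. exact E. }
    destruct H2 as [(x2 & x2' & -> & -> & H2)|(d & u & u' & -> & -> & Hu & Hu' & S')].
    + destruct (is_bijection_dom HM Bf H2) as [D2 D2'].
      split; intros [(d & u & _ & _ & E & _)|(m & d & u & x & -> & E1 & E2 & _ & _ & K)];
        try (destruct (pr_pq E)).
      * apply split2 in E1. destruct E1 as [<- <-]. apply (pr_inj HM) in E2.
        destruct E2 as [_ <-]. right. exists m, c, e', x2'. apply (S m x2 x2' H2) in K. auto 8.
      * apply split2' in E1. destruct E1 as [<- <-]. apply (pr_inj HM) in E2.
        destruct E2 as [_ <-]. right. exists m, c, e, x2. apply (S m x2 x2' H2) in K. auto 8.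
    + split; intros [(d0 & u0 & -> & E1 & E & _)|(m & d0 & u0 & x & _ & _ & E & _)];
        try (destruct (pr_pq (eq_sym E))).
      * apply split2 in E1. destruct E1 as [<- <-]. apply (pr_inj HM) in E. destruct E as [_ E].
        apply (pr_inj HM) in E. destruct E as [-> ->]. left. exists c, e'.
        (* A loop must go to a loop: both images of the one fact have the same components. *)
        assert (E' : e' = u').
        { apply (fact_eq WB He' Hu'). intros m x' Hm.
          destruct (F5 x' (comp_dom WB He' Hm)) as [x Hx].
          apply (S' m x x' Hx), (S m x x' Hx). exact Hm. }
        rewrite E'. auto.
      * apply split2' in E1. destruct E1 as [<- <-]. apply (pr_inj HM) in E. destruct E as [_ E].
        apply (pr_inj HM) in E. destruct E as [-> ->]. left. exists c, e.
        assert (E' : e = u).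
        { apply (fact_eq WA He Hu). intros m x Hm.
          destruct (F2 x (comp_dom WA He Hm)) as [x' Hx].
          apply (S' m x x' Hx), (S m x x' Hx). exact Hm. }
        rewrite E'. auto.
Qed.

End Code.

(** * Absoluteness of structures and codes *)

Section CodeExtension.

Context (V V' : set_universe) (HV : ZFC V) (HV' : ZFC V') (j : extension V V').

(* Finite sequences of elements of V belong to V; minimal counterexamples in V'
   are sought among the lengths of the sequences outside the set of V of all
   finite sequences over X. *)
Lemma finite_sequence_in_ground (w n X : V) (s' : V') : is_omega w -> n ∈ w ->
  is_function s' (j n) (j X) -> exists s, s' = j s.
Proof.
  intros Hw Hn Hs'.
  (* A position lies in a member of [w], hence in the union of [w]; so all finite sequences over [X]
     are subsets of one product. *)
  destruct (zfc_union HV w) as [I HI]. destruct (exists_prod HV I X) as [IX HIX].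
  destruct (zfc_powerset HV IX) as [P HP].
  destruct (separation HV (P := fun s => exists m, m ∈ w /\ is_function s m X) P) as [S HS].
  { unfold is_function, unique, maps_to, is_opair, is_upair. dfn. }
  assert (HS' : forall s m, m ∈ w -> is_function s m X -> s ∈ S).
  { intros s m Hm Hs. apply HS. split; [|eauto]. apply HP. intros t Ht.
    apply (is_functionE HV) in Hs. destruct Hs as (Hs & _).
    destruct (Hs t Ht) as (i & x & Hi & Hx & ->). apply (prod_pr HV _ _ HIX).
    split; [apply HI; eauto|exact Hx]. }
  cut (s' ∈ j S). { intros H. apply incl_elt in H. destruct H as (s & -> & _). eauto. }
  apply NNPP. intros N.
  destruct (separation HV' (P := fun m => exists s, is_function s m (j X) /\ ~ s ∈ j S) (j w))
    as [B HB].
  { unfold is_function, unique, maps_to, is_opair, is_upair. dfn. }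
  destruct (zfc_foundation HV' (x := B)) as (m' & Hm' & Min).
  { exists (j n). apply HB. rewrite incl_in. eauto. }
  apply HB in Hm'. destruct Hm' as [Hm (t' & Ht & Nt)].
  apply incl_elt in Hm. destruct Hm as (m & -> & Hm). apply Nt.
  destruct (omega_inv HV Hw Hm) as [Em|(l & Hl & Sl)].
  - destruct (exists_empty HV) as [e He].
    (* At length zero the sequence is empty, and the empty set is the same in both models. *)
    assert (E : t' = j e).
    { apply (ext_eq HV'). intros z. split; intros Hz.
      - apply (is_functionE HV') in Ht. destruct Ht as (Ht & _).
        destruct (Ht z Hz) as (a & _ & Ha & _). apply incl_elt in Ha.
        destruct Ha as (b & _ & Hb). destruct (Em _ Hb).
      - apply incl_elt in Hz. destruct Hz as (b & _ & Hb). destruct (He _ Hb). }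
    rewrite E. apply incl_in. apply (HS' e m Hm). apply (is_functionE HV).
    split; [|split].
    + intros z Hz. destruct (He _ Hz).
    + intros z Hz. destruct (Em _ Hz).
    + intros z y y' Hz. destruct (He _ Hz).
  - assert (Hlm : j l ∈ j m) by (apply incl_in, Sl; auto).
    destruct (exists_relation HV' (X := j l) (Y := j X)
      (P := fun i x => i ∈ j l /\ pr i x ∈ t')) as (u' & Hu & Ku).
    { dfn. }
    { intros i x [Hi Hx]. split; [exact Hi|]. apply (is_function_dom HV' Ht Hx). }
    assert (Fu : is_function u' (j l) (j X)).
    { apply (is_functionE HV'). split; [exact Ku|]. split.
      - intros i Hi. destruct (is_function_tot HV' (x := i) Ht) as [x Hx].
        + apply incl_elt in Hi. destruct Hi as (i0 & -> & Hi). apply incl_in, Sl. auto.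
        + exists x. apply Hu. auto.
      - intros i x x' H H'. apply Hu in H, H'.
        apply (is_function_fun HV' Ht (proj2 H) (proj2 H')). }
    assert (Du : u' ∈ j S).
    { apply NNPP. intros Nu. apply (Min (j l) Hlm). apply HB. rewrite incl_in. eauto. }
    apply incl_elt in Du. destruct Du as (u & -> & Du).
    apply (incl_function HV HV') in Fu.
    destruct (is_function_tot HV' Ht Hlm) as [x' Hx'].
    destruct (is_function_dom HV' Ht Hx') as [_ Dx]. apply incl_elt in Dx.
    destruct Dx as (x & -> & Dx).
    (* At a successor length, the restriction to [l] is in [V] by minimality and the last value is
       in [V] by transitivity; [t] puts them together inside [V]. *)
    destruct (exists_union2 HV u (upair (pr l x) (pr l x))) as [t Et].
    assert (E : t' = j t).
    { apply (ext_eq HV'). intros z. split; intros Hz.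
      - pose proof Ht as (Kt & _)%(is_functionE HV').
        destruct (Kt z Hz) as (i' & y & Hi & _ & ->).
        apply incl_elt in Hi. destruct Hi as (i & -> & Hi). apply Sl in Hi.
        destruct Hi as [Hi| ->].
        + assert (K : pr (j i) y ∈ j u) by (apply Hu; rewrite incl_in; auto).
          apply incl_elt in K. destruct K as (a & -> & K). apply incl_in, Et. auto.
        + rewrite (is_function_fun HV' Ht Hz Hx'), <- (incl_pr HV HV').
          apply incl_in, Et. rewrite (upairE HV). auto.
      - apply incl_elt in Hz. destruct Hz as (a & -> & Ha). apply Et in Ha.
        destruct Ha as [Ha|Ha].
        + apply (is_functionE HV) in Fu. destruct Fu as (Fu & _).
          destruct (Fu a Ha) as (i & y & _ & _ & ->). apply (incl_in j) in Ha.
          rewrite (incl_pr HV HV') in *. apply Hu in Ha. tauto.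
        + rewrite (upairE HV) in Ha. assert (a = pr l x) as -> by tauto.
          rewrite (incl_pr HV HV'). exact Hx'. }
    rewrite E in *. apply incl_in. apply (HS' t m Hm).
    apply (incl_function HV HV' j). exact Ht.
Qed.

Lemma incl_wf_structure (L : language V) (A : structure V) :
  is_language L -> is_structure L A ->
  wf_structure (j (rel_arity L)) (j (fun_arity L)) (structure_in j A).
Proof.
  intros (w & Hw & Hra & Hfa) (_ & (Y1 & HR) & HR' & (Y2 & HF) & HF').
  assert (rel : forall r n R s, pr r n ∈ rel_arity L -> pr r R ∈ rel_interp A -> s ∈ R ->
    is_function s n (dom A)).
  { intros r n R s Hn HRr Hs. apply (HR' r n R); [apply (maps_toE HV); assumption..|exact Hs]. }
  assert (op : forall g n F, pr g n ∈ fun_arity L -> pr g F ∈ fun_interp A ->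
    is_operation_on F n (dom A)).
  { intros g n F Hn HFg. apply (HF' g n F); apply (maps_toE HV); assumption. }
  split; simpl.
  - intros r n n' H H'. apply (incl_function HV HV' j) in Hra.
    exact (is_function_fun HV' Hra H H').
  - intros r n n' H H'. apply (incl_function HV HV' j) in Hfa.
    exact (is_function_fun HV' Hfa H H').
  - intros r R H. apply (incl_pr_in HV HV') in H. destruct H as (r0 & R0 & -> & -> & H).
    destruct (is_function_dom HV HR H) as [D _].
    destruct (is_function_tot HV Hra D) as [n Hn]. exists (j n). apply (incl_pr_in' HV HV').
    exact Hn.
  - intros r n H. apply (incl_pr_in HV HV') in H. destruct H as (r0 & n0 & -> & -> & H).
    destruct (is_function_dom HV Hra H) as [D _].
    destruct (is_function_tot HV HR D) as [R Hn]. exists (j R). apply (incl_pr_in' HV HV').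
    exact Hn.
  - intros r n n' H H'. apply (incl_function HV HV' j) in HR.
    exact (is_function_fun HV' HR H H').
  - intros r n R s Hn HRr Hs. apply (incl_pr_in HV HV') in Hn, HRr.
    destruct Hn as (r0 & n0 & -> & -> & Hn). destruct HRr as (r1 & R0 & E & -> & HRr).
    apply incl_inj in E. subst r1. apply incl_elt in Hs. destruct Hs as (s0 & -> & Hs).
    apply (incl_function HV HV'). eauto.
  - intros r R H. apply (incl_pr_in HV HV') in H. destruct H as (r0 & R0 & -> & -> & H).
    destruct (is_function_dom HV HF H) as [D _].
    destruct (is_function_tot HV Hfa D) as [n Hn]. exists (j n). apply (incl_pr_in' HV HV').
    exact Hn.
  - intros r n H. apply (incl_pr_in HV HV') in H. destruct H as (r0 & n0 & -> & -> & H).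
    destruct (is_function_dom HV Hfa H) as [D _].
    destruct (is_function_tot HV HF D) as [R Hn]. exists (j R). apply (incl_pr_in' HV HV').
    exact Hn.
  - intros r n n' H H'. apply (incl_function HV HV' j) in HF.
    exact (is_function_fun HV' HF H H').
  - intros g n F e Hn HFg He. apply (incl_pr_in HV HV') in Hn, HFg.
    destruct Hn as (g0 & n0 & -> & -> & Hn). destruct HFg as (g1 & F0 & E & -> & HFg).
    apply incl_inj in E. subst g1. apply incl_elt in He. destruct He as (e0 & -> & He).
    destruct (op _ _ _ Hn HFg) as (T & HT & HFT). apply (is_functionE HV) in HFT.
    destruct HFT as (HFT & _). destruct (HFT _ He) as (s & y & Hs & Hy & ->).
    apply HT in Hs. exists (j s), (j y). rewrite (incl_pr HV HV'), incl_in.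
    split; [reflexivity|]. split; [|exact Hy]. apply (incl_function HV HV'). exact Hs.
  - intros g n F s Hn HFg Hs. apply (incl_pr_in HV HV') in Hn, HFg.
    destruct Hn as (g0 & n0 & -> & -> & Hn). destruct HFg as (g1 & F0 & E & -> & HFg).
    apply incl_inj in E. subst g1. destruct (op _ _ _ Hn HFg) as (T & HT & HFT).
    destruct (is_function_dom HV Hfa Hn) as [_ Wn].
    (* The operation of [V] is defined on the tuples of [V] only; finiteness of the arity shows that
       the given tuple is one of them. *)
    destruct (finite_sequence_in_ground Hw Wn Hs) as [s0 ->].
    apply (incl_function HV HV') in Hs. apply HT in Hs.
    destruct (is_function_tot HV HFT Hs) as [y Hy]. exists (j y). apply (incl_pr_in' HV HV').
    exact Hy.
  - intros g F s y y' HFg H H'. apply (incl_pr_in HV HV') in HFg.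
    destruct HFg as (g0 & F0 & -> & -> & HFg).
    destruct (is_function_dom HV HF HFg) as [D _].
    destruct (is_function_tot HV Hfa D) as [n Hn].
    destruct (op _ _ _ Hn HFg) as (T & _ & HFT). apply (incl_function HV HV' j) in HFT.
    exact (is_function_fun HV' HFT H H').
Qed.

Lemma incl_fact (p q : V) (A : structure V) (c' e' : V') :
  fact (j p) (j q) (structure_in j A) c' e' <->
  exists c e, c' = j c /\ e' = j e /\ fact p q A c e.
Proof.
  unfold fact. simpl. split.
  - intros [(r & R & -> & Hr & He)|(r & R & -> & Hr & He)];
      apply (incl_pr_in HV HV') in Hr; destruct Hr as (r0 & R0 & -> & -> & Hr);
      apply incl_elt in He; destruct He as (e & -> & He);
      [exists (pr p r0), e|exists (pr q r0), e]; rewrite (incl_pr HV HV');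
      (do 2 (split; [reflexivity|])); eauto 8.
  - intros (c & e & -> & -> & [(r & R & -> & Hr & He)|(r & R & -> & Hr & He)]);
      [left|right]; exists (j r), (j R);
      rewrite (incl_pr HV HV'), (incl_pr_in' HV HV'), incl_in; auto.
Qed.

Lemma incl_comp (p q c e : V) (m' x' : V') : comp (j p) (j q) (j c) (j e) m' x' <->
  exists m x, m' = j m /\ x' = j x /\ comp p q c e m x.
Proof.
  unfold comp. split.
  - intros [(r & i & E & -> & H)|(g & s & y & E & E' & [(i & -> & H)|[-> ->]])].
    + destruct (incl_pr_inv HV HV' E) as (p0 & r0 & -> & E0 & ->). apply incl_inj in E0. subst p0.
      apply (incl_pr_in HV HV') in H. destruct H as (i0 & x & -> & -> & H).
      exists (pr p i0), x. rewrite (incl_pr HV HV'). eauto 10.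
    + destruct (incl_pr_inv HV HV' E) as (q0 & g0 & -> & E0 & ->). apply incl_inj in E0. subst q0.
      destruct (incl_pr_inv HV HV' E') as (s0 & y0 & -> & -> & ->).
      apply (incl_pr_in HV HV') in H. destruct H as (i0 & x & -> & -> & H).
      exists (pr p i0), x. rewrite (incl_pr HV HV'). do 2 (split; [reflexivity|]). right.
      exists g0, s0, y0. eauto 8.
    + destruct (incl_pr_inv HV HV' E) as (q0 & g0 & -> & E0 & ->). apply incl_inj in E0. subst q0.
      destruct (incl_pr_inv HV HV' E') as (s0 & y0 & -> & -> & ->).
      exists (pr q q), y0. rewrite (incl_pr HV HV'). do 2 (split; [reflexivity|]). right.
      exists g0, s0, y0. auto.
  - intros (m & x & -> & -> & [(r & i & -> & -> & H)|(g & s & y & -> & -> & [(i & -> & H)|[-> ->]])]).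
    + left. exists (j r), (j i). rewrite !(incl_pr HV HV'), (incl_pr_in' HV HV'). auto.
    + right. exists (j g), (j s), (j y). rewrite !(incl_pr HV HV').
      do 2 (split; [reflexivity|]). left. exists (j i). rewrite (incl_pr_in' HV HV'). auto.
    + right. exists (j g), (j s), (j y). rewrite !(incl_pr HV HV'). auto.
Qed.

Lemma incl_code (p q : V) (A : structure V) (X G : V) :
  is_code p q A X G -> is_code (j p) (j q) (structure_in j A) (j X) (j G).
Proof.
  intros [HX HG]. split.
  - intros z'. split.
    + intros H. apply incl_elt in H. destruct H as (z & -> & H). apply HX in H.
      destruct H as [(x & Hx & ->)|(c & e & -> & H)]; [left|right].
      * exists (j x). simpl. rewrite incl_in, (incl_pr HV HV'). auto.
      * exists (j c), (j e). rewrite !(incl_pr HV HV'), incl_fact. split; [reflexivity|]. eauto.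
    + intros [(x' & Hx & ->)|(c' & e' & -> & H)].
      * simpl in Hx. apply incl_elt in Hx. destruct Hx as (x & -> & Hx).
        rewrite <- (incl_pr HV HV'). apply incl_in, HX. left. eauto.
      * apply incl_fact in H. destruct H as (c & e & -> & -> & H).
        rewrite <- !(incl_pr HV HV'). apply incl_in, HX. right. eauto.
  - intros k' z1' z2'. rewrite (incl_pr2_in HV HV'). split.
    + intros (k & z1 & z2 & -> & -> & -> & H). apply HG in H.
      destruct H as [(c & e & -> & -> & -> & H)|(m & c & e & x & -> & -> & -> & Hx & H & H')].
      * left. exists (j c), (j e). rewrite !(incl_pr HV HV'), incl_fact.
        do 3 (split; [reflexivity|]). eauto.
      * right. exists (j m), (j c), (j e), (j x).
        rewrite !(incl_pr HV HV'), incl_fact, incl_comp. simpl. rewrite incl_in.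
        do 3 (split; [reflexivity|]). split; [exact Hx|].
        split; [exists c, e|exists m, x]; auto.
    + intros [(c' & e' & -> & -> & -> & H)|(m' & c' & e' & x' & -> & -> & -> & Hx & H & H')];
        apply incl_fact in H; destruct H as (c & e & -> & -> & H).
      * exists (pr p c), (pr q (pr c e)), (pr q (pr c e)). rewrite !(incl_pr HV HV').
        do 3 (split; [reflexivity|]). apply HG. left. eauto 6.
      * apply incl_comp in H'. destruct H' as (m & x & -> & -> & H').
        simpl in Hx. apply incl_in in Hx.
        exists (pr q m), (pr q (pr c e)), (pr p x). rewrite !(incl_pr HV HV').
        do 3 (split; [reflexivity|]). apply HG. right. exists m, c, e, x. auto 8.
Qed.

End CodeExtension.

(** * The structure [C] and its behaviour in extensions *)

Theorem theorem1p13 (V : set_universe) (HV : ZFC V) (L : language V)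
  (A B : structure V) (HL : is_language L)
  (HA : is_structure L A) (HB : is_structure L B) :
  exists (L' : language V) (C : structure V),
    is_language L' /\ is_structure L' C /\
    forall (V' : set_universe) (HV' : ZFC V') (j : extension V V'),
      isomorphic (language_in j L) (structure_in j A) (structure_in j B)
      <-> ~ rigid (language_in j L') (structure_in j C).
Proof.
  destruct (exists_empty HV) as [p Hp].
  (* The two distinct sets are the empty set and its singleton. They label the roots and serve as
     tags, both in the codes and in the names of the relations of the tree. *)
  set (q := upair p p).
  assert (Hpq : p <> q).
  { intros E. apply (Hp p). rewrite E at 2. apply (upairE HV). auto. }
  destruct (exists_code HV p q A) as (XA & GA & CA).
  destruct (exists_code HV p q B) as (XB & GB & CB).
  destruct (exists_union2 HV XA XB) as [XX HXX].
  (* All labels must be available as indices: the elements of both codes label the children, [p] and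
     [q] the roots. *)
  destruct (exists_union2 HV XX (upair p q)) as [J HJ].
  destruct (@exists_tree V HV J XA XB p q) as (W & rp & rq & E & rk & T); try assumption.
  { apply HJ. rewrite (upairE HV). auto. }
  { apply HJ. rewrite (upairE HV). auto. }
  { intros z Hz. apply HJ. rewrite HXX. auto. }
  { intros z Hz. apply HJ. rewrite HXX. auto. }
  destruct (exists_field HV GA) as [KA HKA]. destruct (exists_field HV GB) as [KB HKB].
  destruct (exists_union2 HV KA KB) as [KAB HKAB].
  destruct (exists_union2 HV KAB J) as [K0 HK0].
  destruct (exists_prod HV (upair p q) K0) as [K HK].
  assert (dom_rel : forall k w w', tree_rel GA GB p q E k w w' -> k ∈ K /\ w ∈ W /\ w' ∈ W).
  { intros k w w' [(i & x & -> & H)|(l & v & i & y & x & x' & -> & H1 & H2 & _ & H)].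
    - destruct (tree_dom T H) as (H1 & H2 & H3 & _). split; [|auto].
      apply (prod_pr HV _ _ HK). rewrite (upairE HV), HK0. auto.
    - destruct (tree_dom T H1) as (_ & K1 & _). destruct (tree_dom T H2) as (_ & K2 & _).
      split; [|auto]. apply (prod_pr HV _ _ HK). rewrite (upairE HV), HK0, HKAB.
      split; [auto|]. left.
      destruct H as [[_ H]|[_ H]]; [right; apply (HKB _ _ H)|left; apply (HKA _ _ H)]. }
  destruct (@exists_ternary V HV K W (tree_rel GA GB p q E)) as [G HG].
  { unfold tree_rel, child, label. dfn. }
  { exact dom_rel. }
  destruct (@binary_language V HV W K G) as (L' & C & HL' & HC & DC & Iso).
  { exists rp. apply (tree_rp T). }
  { intros k w w' H. apply dom_rel, HG. exact H. }
  exists L', C. split; [exact HL'|]. split; [exact HC|]. intros V' HV' j.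
  assert (Hpq' : j p <> j q) by (intros K1; apply incl_inj in K1; auto).
  pose proof (incl_wf_structure HV HV' j HL HA) as WA.
  pose proof (incl_wf_structure HV HV' j HL HB) as WB.
  pose proof (incl_code HV HV' j CA) as CA'. pose proof (incl_code HV HV' j CB) as CB'.
  (* Both sides range over maps of [V'], possibly new ones; only the codes come from [V]. *)
  assert (Step : isomorphic (language_in j L) (structure_in j A) (structure_in j B) <->
    exists f, biniso (j XA) (j GA) (j XB) (j GB) f).
  { split.
    - exact (code_of_iso HV' Hpq' WA WB CA' CB').
    - intros [h Hh]. exact (iso_of_code HV' Hpq' _ _ WA WB CA' CB' Hh). }
  rewrite Step, (tree_rigid_iff HV' (incl_tree HV HV' j T) (incl_tree_rel HV HV' j HG)).
  unfold rigid. simpl. rewrite DC. split.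
  - intros (s & Hs & w & Hw & N) R. apply N. apply (maps_toE HV').
    apply R; [apply (Iso V' HV' j); exact Hs|exact Hw].
  (* Failure of rigidity is a negated universal statement; the automorphism and the moved element
     are obtained classically. *)
  - intros N. apply NNPP. intros N'. apply N. intros s Hs w Hw. apply (maps_toE HV').
    apply (Iso V' HV' j) in Hs. apply NNPP. intros Nw. apply N'. eauto.
Qed.
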